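(* Let $X$ be a Banach space such that $X^*$ has the approximation property, let $\{T_0(t)\}_{t\in\mathbb R}$ be the translation semigroup on $L^1(\mathbb R)$, and let $\mathcal S:=\{T(t):=T_0(t)\otimes I\}_{t\in\mathbb R}$ on $L^1(\mathbb R,X)$. Then, depending on a minimal idempotent $P^{\odot}\in\mathcal S_0^{\odot}$, there is a splitting $$BUC(\mathbb R,X^* )=BUC(\mathbb R,X^* )_a\oplus BUC(\mathbb R,X^* )_0 ,$$ where $BUC(\mathbb R,X^* )_a=R(P^\odot)$ and $BUC(\mathbb R,X^* )_0=N(P^\odot)$. This splitting is nontrivial because $$AP(\mathbb R,X^* )\subset BUC(\mathbb R,X^* )_a\quad\text{and}\quad W_0(\mathbb R,X^* )\subset BUC(\mathbb R,X^* )_0 .$$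
   Context: A Banach space $Z$ has the approximation property if for every compact $K\subset Z$ and $\varepsilon>0$ there is a bounded finite-rank operator $T:Z\to Z$ with $\|Tz-z\|\le\varepsilon$ for all $z\in K$. $(T(t)h)(s)=h(s-t)$ for $h\in L^1(\mathbb R,X)$. $BUC(\mathbb R,X^* )$ is the space of bounded uniformly continuous functions with sup norm. When $X^*$ has the approximation property, it is known that the sun dual $L^1(\mathbb R,X)^\odot$ (the set of functionals on which the adjoint group is strongly continuous) equals $BUC(\mathbb R,X^* )$ via $\langle h,f\rangle=\int_{\mathbb R}\langle h(s),f(s)\rangle\,ds$, and then $T^\odot(t)f=f(\cdot+t)$. $\mathcal S_0^\odot$ is the closure of $\{T^\odot(t):t\in\mathbb R\}$ in $L(BUC(\mathbb R,X^* ))$ with respect to the topology in which $V_\lambda\to V$ iff $\langle h,V_\lambda f\rangle\to\langle h,Vf\rangle$ for all $h\in L^1(\mathbb R,X)$, $f\in BUC(\mathbb R,X^* )$. It is compact, a semigroup under composition, and $W\mapsto WV$ is continuous on it. On idempotents put $e\le_Lf$ iff $ef=e$, $e\le_R f$ iff $fe=e$; a minimal idempotent is one minimal for $\le_L$ (equivalently $\le_R$), where $a$ is minimal if $a'\le a$ implies $a\le a'$. $AP(\mathbb R,X^* )$: bounded continuous $f:\mathbb R\to X^*$ whose set of translates $\{f(\cdot+\tau):\tau\in\mathbb R\}$ is relatively norm compact in $C_b(\mathbb R,X^* )$. $W(\mathbb R,X^* )$ (Eberlein weakly almost periodic functions): those with weakly relatively compact set of translates in $C_b(\mathbb R,X^*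 )$; $W_0(\mathbb R,X^* )$: those $f\in W(\mathbb R,X^* )$ with $f(\cdot+t_n)\to0$ weakly for some sequence $(t_n)\subset\mathbb R$. (Such functions are uniformly continuous.) *)

(* Defs.v *)
From HB Require Import structures.
From mathcomp Require Import all_boot all_order all_algebra.
From mathcomp Require Import complex.
From mathcomp Require Import all_classical all_reals all_analysis.

Set Implicit Arguments.
Unset Strict Implicit.
Unset Printing Implicit Defensive.

Import Order.TTheory GRing.Theory Num.Theory.
Import numFieldNormedType.Exports.

Local Open Scope classical_set_scope.
Local Open Scope ring_scope.

(* A Banach space may be real or complex: its scalar field
   [scalar_field R k] is R itself or R[i].  The norm of a normed module over
   R[i] takes its (real, nonnegative) values in R[i]; [reK] brings them back
   to R. *)
Variant scalar_kind := RealScalars | ComplexScalars.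

Definition scalar_field (R : realType) (k : scalar_kind) : numFieldType :=
  match k with RealScalars => R | ComplexScalars => R[i] end.

Section scalar_field.
Variable R : realType.

Definition reK (k : scalar_kind) : scalar_field R k -> R :=
  match k with
  | RealScalars => fun x : R => x
  | ComplexScalars => fun z : R[i] => complex.Re z
  end.

Definition imK (k : scalar_kind) : scalar_field R k -> R :=
  match k with
  | RealScalars => fun x : R => 0
  | ComplexScalars => fun z : R[i] => complex.Im z
  end.

Definition mkK (k : scalar_kind) : R -> R -> scalar_field R k :=
  match k with
  | RealScalars => fun a b : R => a
  | ComplexScalars => fun a b : R => Complex a b
  end.

Variable k : scalar_kind.
Local Notation K := (scalar_field R k).

Lemma mkK_ge0 (a : R) : 0 <= a -> (0 : K) <= mkK k a 0.
Proof. by case: k => //= a0; rewrite lecE /= eqxx. Qed.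

Lemma mkK_reK (x : K) : 0 <= x -> mkK k (reK x) 0 = x.
Proof.
case: k x => //= -[a b]; rewrite lecE /= => /andP[/eqP -> _].
by [].
Qed.

Lemma ler_mkK (a b : R) : (mkK k a 0 <= mkK k b 0) = (a <= b).
Proof. by case: k => //=; rewrite lecE /= eqxx. Qed.

Lemma ler_reK (x y : K) : x <= y -> reK x <= reK y.
Proof. by case: k x y => //= -[a b] [c d]; rewrite lecE /= => /andP[]. Qed.

End scalar_field.
Arguments mkK {R k}.

Section supnorm.
Variables (R : realType) (k : scalar_kind).
Local Notation K := (scalar_field R k).
Variables (I : Type) (D : set I) (Z : normedModType K).

Definition bounded_on (f : I -> Z) :=
  exists M : K, forall i, D i -> `|f i| <= M.

Definition supnorm (f : I -> Z) : K :=
  mkK (sup [set reK `|f i| | i in D]) 0.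

Hypothesis D0 : D !=set0.

Lemma supnorm_ub f i : bounded_on f -> D i -> `|f i| <= supnorm f.
Proof.
move=> [M fM] Di; rewrite -[leLHS]mkK_reK// ler_mkK.
apply: ub_le_sup; last by exists i.
by exists (reK M) => _ [j Dj <-]; exact/ler_reK/fM.
Qed.

Lemma supnorm_le f (M : K) : (forall i, D i -> `|f i| <= M) -> supnorm f <= M.
Proof.
move=> fM; case: D0 => i0 Di0.
have M0 : 0 <= M by rewrite (le_trans _ (fM _ Di0)).
rewrite -[leRHS]mkK_reK// ler_mkK; apply: ge_sup.
  by exists (reK `|f i0|), i0.
by move=> _ [j Dj <-]; exact/ler_reK/fM.
Qed.

Lemma supnormD f g : bounded_on f -> bounded_on g ->
  supnorm (f + g) <= supnorm f + supnorm g.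
Proof.
move=> bf bg; apply: supnorm_le => i Di.
by rewrite (le_trans (ler_normD _ _))// lerD// supnorm_ub.
Qed.

Lemma supnormZ (a : K) f : bounded_on f -> supnorm (a *: f) = `|a| * supnorm f.
Proof.
move=> bf.
have H b g : bounded_on g -> supnorm (b *: g) <= `|b| * supnorm g.
  move=> bg; apply: supnorm_le => i Di.
  by rewrite normrZ ler_wpM2l// supnorm_ub.
apply/eqP; rewrite eq_le H//=.
have [->|a0] := eqVneq a 0.
  rewrite normr0 mul0r; case: D0 => i Di.
  apply: le_trans (@supnorm_ub (0 *: f) i _ Di) => //.
  by exists 0 => j _; rewrite /= scale0r normr0.
have bg : bounded_on (a *: f).
  case: bf => M fM; exists (`|a| * M) => i Di.
  by rewrite normrZ ler_wpM2l// fM.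
rewrite mulrC -ler_pdivlMr ?normr_gt0// mulrC -normfV.
by apply: le_trans (H _ _ bg); rewrite scalerA mulVf// scale1r.
Qed.

Lemma supnorm0 f i : bounded_on f -> supnorm f = 0 -> D i -> f i = 0.
Proof.
move=> bf f0 Di; apply/eqP; rewrite -normr_eq0 eq_le normr_ge0 andbT -f0.
exact: supnorm_ub.
Qed.

End supnorm.

(* [blin V W] is the space of bounded linear operators from V to W under the
   operator norm (the supremum of |f x| over the closed unit ball). *)
Section blin.
Variables (R : realType) (k : scalar_kind).
Local Notation K := (scalar_field R k).
Variables V W : normedModType K.

Definition blin_pred : {pred V -> W} :=
  mem [set f : V -> W | linear f /\ continuous f].

Record blin := Blin { blin_fun :> V -> W ; blin_funP : blin_fun \in blin_pred }.

HB.instance Definition _ := [isSub for blin_fun].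
HB.instance Definition _ := [Choice of blin by <:].

Lemma blin_submod_closed : submod_closed blin_pred.
Proof.
split=> [|a f g].
  rewrite inE; split; last by move=> x; exact: cvg_cst.
  by move=> b x y /=; rewrite scaler0 addr0.
rewrite !inE => -[lf cf] [lg cg]; split.
  move=> b x y; rewrite -![(_ + _ : V -> W) _]/(a *: f _ + g _) lf lg.
  by rewrite !scalerDr !scalerA mulrC addrACA.
by move=> x; apply: cvgD; [apply: cvgZr; exact: cf|exact: cg].
Qed.

HB.instance Definition _ :=
  GRing.isSubmodClosed.Build _ _ blin_pred blin_submod_closed.
HB.instance Definition _ := [SubChoice_isSubLmodule of blin by <:].

Lemma blin_linear (f : blin) : linear f.
Proof. by have := blin_funP f; rewrite inE => -[]. Qed.

HB.instance Definition _ (f : blin) :=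
  GRing.isLinear.Build _ _ _ _ (blin_fun f) (@blin_linear f).

Lemma blin_continuous (f : blin) : continuous f.
Proof. by have := blin_funP f; rewrite inE => -[]. Qed.

Let ball1 : set V := [set x | `|x| <= 1].

Let ball10 : ball1 !=set0.
Proof. by exists 0; rewrite /ball1/= normr0 ler01. Qed.

Let blin_bounded (f : blin) : bounded_on ball1 f.
Proof.
have /linear_boundedP/pinfty_ex_gt0[M M0 fM] :=
  continuous_linear_bounded 0 (@blin_continuous f 0).
by exists M => x x1; rewrite (le_trans (fM x))// ler_piMr// ltW.
Qed.

Definition blin_norm (f : blin) : K := supnorm [set x : V | `|x| <= 1] f.

Let blin_normD f g : blin_norm (f + g) <= blin_norm f + blin_norm g.
Proof. by apply: (supnormD ball10); exact: blin_bounded. Qed.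

Let blin_normZ (a : K) f : blin_norm (a *: f) = `|a| * blin_norm f.
Proof. by apply: (supnormZ ball10); exact: blin_bounded. Qed.

Let blin_norm0 f : blin_norm f = 0 -> f = 0.
Proof.
move=> f0; apply/val_inj/funext => x /=.
have [->|x0] := eqVneq x 0; first exact: linear0.
have x1 : ball1 (`|x|^-1 *: x).
  by rewrite /ball1/= normrZ normfV normr_id mulVf// normr_eq0.
have := supnorm0 (@blin_bounded f) f0 x1.
rewrite linearZ => /eqP; rewrite scaler_eq0 invr_eq0 normr_eq0 (negPf x0).
by move=> /eqP.
Qed.

HB.instance Definition _ :=
  Lmodule_isNormed.Build K blin blin_normD blin_normZ blin_norm0.

End blin.

Section blin_comp.
Variables (R : realType) (k : scalar_kind).
Variables U V W : normedModType (scalar_field R k).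

Lemma blin_comp_subproof (g : blin V W) (f : blin U V) :
  (g \o f) \in @blin_pred R k U W.
Proof.
rewrite inE; split; first by move=> a x y /=; rewrite !linearP.
by move=> x; apply: continuous_comp; exact: blin_continuous.
Qed.

Definition blin_comp g f : blin U W := Blin (blin_comp_subproof g f).

End blin_comp.

Definition dual (R : realType) (k : scalar_kind)
  (V : normedModType (scalar_field R k)) := blin V (scalar_field R k)^o.

(* [weak V] is a copy of V with the weak topology: the initial topology of the
   evaluation map from V to the functions on its dual. *)
Definition eval_dual (R : realType) (k : scalar_kind)
    (V : normedModType (scalar_field R k)) (x : V) :
    {ptws dual V -> scalar_field R k} :=
  fun phi => phi x.
Definition weak (R : realType) (k : scalar_kind)
    (V : normedModType (scalar_field R k)) :=
  initial_topology (@eval_dual R k V).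
HB.instance Definition _ R k V := Topological.on (@weak R k V).

Definition finite_rank (R : realType) (k : scalar_kind)
    (V W : normedModType (scalar_field R k)) (T : blin V W) :=
  exists (n : nat) (b : 'I_n -> W), forall x,
    exists c : 'I_n -> scalar_field R k, T x = \sum_(i < n) c i *: b i.

Definition approximation_property (R : realType) (k : scalar_kind)
    (Z : normedModType (scalar_field R k)) :=
  forall (C : set Z) (e : scalar_field R k), compact C -> 0 < e ->
    exists2 T : blin Z Z, finite_rank T & forall z, C z -> `|T z - z| <= e.

Section Cb.
Variables (R : realType) (k : scalar_kind).
Local Notation K := (scalar_field R k).
Variable Z : normedModType K.

Lemma bounded_on_submod (I : Type) (D : set I) (a : K) (f g : I -> Z) :
  bounded_on D f -> bounded_on D g -> bounded_on D (a *: f + g).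
Proof.
move=> [M fM] [N gN]; exists (`|a| * M + N) => i Di.
rewrite -[(_ + _ : I -> Z) _]/(a *: f i + g i) (le_trans (ler_normD _ _))//.
by rewrite lerD ?gN// normrZ ler_wpM2l// fM.
Qed.

Lemma bounded_on0 (I : Type) (D : set I) : bounded_on D (0 : I -> Z).
Proof. by exists 0 => i _; rewrite normr0. Qed.

Definition Cb_pred : {pred R -> Z} :=
  mem [set f : R -> Z | continuous f /\ bounded_on setT f].

Record Cb := MkCb { Cb_fun :> R -> Z ; Cb_funP : Cb_fun \in Cb_pred }.

HB.instance Definition _ := [isSub for Cb_fun].
HB.instance Definition _ := [Choice of Cb by <:].

Lemma Cb_submod_closed : submod_closed Cb_pred.
Proof.
split=> [|a f g]; rewrite !inE.
  by split; [move=> x; exact: cvg_cst|exact: bounded_on0].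
move=> -[cf bf] [cg bg]; split; last exact: bounded_on_submod.
by move=> x; apply: cvgD; [apply: cvgZr; exact: cf|exact: cg].
Qed.

HB.instance Definition _ :=
  GRing.isSubmodClosed.Build _ _ Cb_pred Cb_submod_closed.
HB.instance Definition _ := [SubChoice_isSubLmodule of Cb by <:].

Lemma Cb_continuous (f : Cb) : continuous f.
Proof. by have := Cb_funP f; rewrite inE => -[]. Qed.

Lemma Cb_bounded (f : Cb) : bounded_on setT f.
Proof. by have := Cb_funP f; rewrite inE => -[]. Qed.

Definition Cb_norm (f : Cb) : K := supnorm setT f.

Let T0 : [set: R] !=set0. Proof. by exists 0. Qed.

Let Cb_normD f g : Cb_norm (f + g) <= Cb_norm f + Cb_norm g.
Proof. by apply: (supnormD T0); exact: Cb_bounded. Qed.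

Let Cb_normZ (a : K) f : Cb_norm (a *: f) = `|a| * Cb_norm f.
Proof. by apply: (supnormZ T0); exact: Cb_bounded. Qed.

Let Cb_norm0 f : Cb_norm f = 0 -> f = 0.
Proof.
move=> f0; apply/val_inj/funext => s /=.
exact: supnorm0 (@Cb_bounded f) f0 _.
Qed.

HB.instance Definition _ :=
  Lmodule_isNormed.Build K Cb Cb_normD Cb_normZ Cb_norm0.

Lemma Cb_translate_subproof (t : R) (f : Cb) : (fun s => f (s + t)) \in Cb_pred.
Proof.
rewrite inE; split; last first.
  by have [M fM] := Cb_bounded f; exists M => s _; exact: fM.
move=> s; apply: (@continuous_comp _ _ _ (fun s => s + t) f).
  by apply: cvgD; [exact: cvg_id|exact: cvg_cst].
exact: Cb_continuous.
Qed.

Definition Cb_translate t f : Cb := MkCb (Cb_translate_subproof t f).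

End Cb.

Section BUC.
Variables (R : realType) (k : scalar_kind).
Local Notation K := (scalar_field R k).
Variable Z : normedModType K.

Definition BUC_pred : {pred R -> Z} :=
  mem [set f : R -> Z | unif_continuous f /\ bounded_on setT f].

Record BUC := MkBUC { BUC_fun :> R -> Z ; BUC_funP : BUC_fun \in BUC_pred }.

HB.instance Definition _ := [isSub for BUC_fun].
HB.instance Definition _ := [Choice of BUC by <:].

Lemma unif_continuous_normP (f : R -> Z) : unif_continuous f <->
  forall e : K, 0 < e -> exists2 d : R, 0 < d &
    forall s t, `|s - t| < d -> `|f s - f t| < e.
Proof.
rewrite /unif_continuous -(@entourage_ballE R R) -(@entourage_ballE K Z).
split=> [uf e e0|uf].
  have [|d d0 df] := uf [set xy | ball xy.1 e xy.2]; first by exists e.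
  exists d => // s t st; have := df (s, t); rewrite -!ball_normE /=; exact.
move=> U [e /= e0 eU]; have [d d0 df] := uf e e0.
exists d => // -[s t] /= st; apply: eU => /=.
by move: st; rewrite -!ball_normE; exact: df.
Qed.

Lemma BUC_submod_closed : submod_closed BUC_pred.
Proof.
split=> [|a f g]; rewrite !inE.
  split; last exact: bounded_on0.
  by apply/unif_continuous_normP => e e0; exists 1 => // s t _;
  rewrite subr0 normr0.
move=> -[/unif_continuous_normP uf bf] [/unif_continuous_normP ug bg].
split; last exact: bounded_on_submod.
apply/unif_continuous_normP => e e0.
have a0 : 0 < `|a| + 1 by rewrite ltr_wpDl.
have [d1 d10 fd] := uf (e / 2 / (`|a| + 1))
  (divr_gt0 (divr_gt0 e0 (ltr0n _ 2)) a0).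
have [d2 d20 gd] := ug (e / 2) (divr_gt0 e0 (ltr0n _ 2)).
exists (Num.min d1 d2); first by rewrite lt_min d10.
move=> s t; rewrite lt_min => /andP[/fd fst /gd gst].
rewrite -![(_ + _ : R -> Z) _]/(a *: f _ + g _) opprD addrACA -scalerBr.
rewrite (le_lt_trans (ler_normD _ _))// [e in _ < e]splitr ler_ltD// normrZ.
apply: le_trans (ler_wpM2l (normr_ge0 a) (ltW fst)) _.
rewrite mulrCA ler_piMr ?divr_ge0 ?(ltW e0)//.
by rewrite ler_pdivrMr// mul1r lerDl.
Qed.

HB.instance Definition _ :=
  GRing.isSubmodClosed.Build _ _ BUC_pred BUC_submod_closed.
HB.instance Definition _ := [SubChoice_isSubLmodule of BUC by <:].

Lemma BUC_unif_continuous (f : BUC) : unif_continuous f.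
Proof. by have := BUC_funP f; rewrite inE => -[]. Qed.

Lemma BUC_bounded (f : BUC) : bounded_on setT f.
Proof. by have := BUC_funP f; rewrite inE => -[]. Qed.

Definition BUC_norm (f : BUC) : K := supnorm setT f.

Let T0 : [set: R] !=set0. Proof. by exists 0. Qed.

Let BUC_normD f g : BUC_norm (f + g) <= BUC_norm f + BUC_norm g.
Proof. by apply: (supnormD T0); exact: BUC_bounded. Qed.

Let BUC_normZ (a : K) f : BUC_norm (a *: f) = `|a| * BUC_norm f.
Proof. by apply: (supnormZ T0); exact: BUC_bounded. Qed.

Let BUC_norm0 f : BUC_norm f = 0 -> f = 0.
Proof.
move=> f0; apply/val_inj/funext => s /=.
exact: supnorm0 (@BUC_bounded f) f0 _.
Qed.

HB.instance Definition _ :=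
  Lmodule_isNormed.Build K BUC BUC_normD BUC_normZ BUC_norm0.

Lemma BUC_Cb_subproof (f : BUC) : (f : R -> Z) \in @Cb_pred R k Z.
Proof.
rewrite inE; split; last exact: BUC_bounded.
move=> s; apply/cvgrPdist_lt => e e0.
have /unif_continuous_normP/(_ e e0)[d d0 df] := BUC_unif_continuous f.
by near=> t; apply: df; near: t; exact: cvgr_dist_lt.
Unshelve. all: by end_near. Qed.

Definition BUC_Cb (f : BUC) : Cb Z := MkCb (BUC_Cb_subproof f).

Lemma translate_subproof (t : R) (f : BUC) : (fun s => f (s + t)) \in BUC_pred.
Proof.
rewrite inE; split; last first.
  by have [M fM] := BUC_bounded f; exists M => s _; exact: fM.
apply/unif_continuous_normP => e e0.
have /unif_continuous_normP/(_ e e0)[d d0 df] := BUC_unif_continuous f.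
by exists d => // s r sr; apply: df; rewrite opprD addrACA subrr addr0.
Qed.

Definition translate t f : BUC := MkBUC (translate_subproof t f).

Let translate_linear t : linear (translate t).
Proof. by move=> a f g; apply/val_inj/funext. Qed.

HB.instance Definition _ t :=
  GRing.isLinear.Build _ _ _ _ (translate t) (translate_linear t).

Lemma translate_blin_subproof t : translate t \in @blin_pred R k BUC BUC.
Proof.
rewrite inE; split; first exact: translate_linear.
apply: bounded_linear_continuous; apply/linear_boundedP.
near=> r => f; have r1 : 1 <= r by near: r; exact: nbhs_pinfty_ge.
apply: (@le_trans _ _ `|f|); last by rewrite ler_peMl.
apply: (supnorm_le T0) => s _.
by apply: (supnorm_ub (@BUC_bounded f)).
Unshelve. all: by end_near. Qed.

(* The sun adjoint of the translation by t: it maps f to f(. + t) (see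
   [pairing_translate] below). *)
Definition Tsun t : blin BUC BUC := Blin (translate_blin_subproof t).

End BUC.

Section lebesgue_translation.
Variables (R : realType) (t : R).
Local Notation mu := (@lebesgue_measure R).

Let shiftt : measurableTypeR R -> measurableTypeR R := fun s => s + t.

Let mshift : measurable_fun setT shiftt.
Proof.
apply: (@measurable_realfun.measurable_funD _ (measurableTypeR R) R
    setT id (cst t)).
  exact: measurable_id.
exact: measurable_cst.
Qed.

Lemma measurable_preimage_shift (A : set (measurableTypeR R)) :
  measurable A ->
  measurable ((fun s : R => s + t) @^-1` A : set (measurableTypeR R)).
Proof. by move=> mA; rewrite -[_ @^-1` _]setTI; exact: mshift. Qed.

Lemma lebesgue_measure_shift (A : set (measurableTypeR R)) : measurable A ->
  mu ((fun s : R => s + t) @^-1` A) = mu A.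
Proof.
move=> mA.
have [nu nuE] : exists nu : {measure set (measurableTypeR R) -> \bar R},
    nu = pushforward mu shiftt :> (set _ -> _).
  by exists (measure_function_pushforward__canonical__measure_function_Measure
               mu mshift).
rewrite -[LHS]/(pushforward mu shiftt A) -nuE; apply/esym.
apply: lebesgue_measure_unique mA => _ [[a b] _ <-].
rewrite nuE /pushforward (_ : _ @^-1` _ = `]a - t, b - t]%classic).
  rewrite [LHS]lebesgue_measure_itv [RHS]lebesgue_measure_itv /=.
  rewrite !lte_fin ltrD2r.
  by case: ifPn => // _; rewrite -!EFinD opprD opprK addrACA [- t + _]addrC
    subrr addr0.
by apply/seteqP; split=> s /=; rewrite /shiftt !in_itv/= ltrBlDr lerBrDr.
Qed.

End lebesgue_translation.

Section integral_translation.
Local Open Scope ereal_scope.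
Variable R : realType.
Local Notation mu := (@lebesgue_measure R).
Import HBSimple HBNNSimple.

Let le_ge0_integral_shift (t : R) (f : R -> \bar R) : (forall s, 0 <= f s) ->
  \int[mu]_s f (s + t)%R <= \int[mu]_s f s.
Proof.
move=> f0; rewrite !ge0_integralTE//.
apply: le_ereal_sup => _ [h /= hf <-].
pose g (s : measurableTypeR R) := h (s - t)%R.
have mg : measurable_fun setT g.
  apply: (@measurableT_comp _ _ _ _ _ _ h) => //.
  apply: (@measurable_realfun.measurable_funD _ (measurableTypeR R) R
    setT id (cst (- t)%R)).
    exact: measurable_id.
  exact: measurable_cst.
have fg : finite_set (range g).
  by apply: sub_finite_set (fimfunP h) => _ [s _ <-]; exists (s - t)%R.
have g0 s : (0 <= g s)%R by exact: fun_ge0.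
pose g1 := isMeasurableFun.Build _ _ _ _ g mg.
pose g2 := FiniteImage.Build _ _ g fg.
pose g3 := isNonNegFun.Build _ _ g g0.
pose gg : {nnsfun measurableTypeR R >-> R} := HB.pack g g1 g2 g3.
exists gg.
  by move=> s /=; have := hf (s - t)%R; rewrite subrK.
rewrite !sintegralET; apply: eq_fsbigr => x _; congr (_ * _).
by rewrite -(@lebesgue_measure_shift R (- t)%R (h @^-1` [set x])).
Qed.

Lemma ge0_integral_shift (t : R) (f : R -> \bar R) : (forall s, 0 <= f s) ->
  \int[mu]_s f (s + t)%R = \int[mu]_s f s.
Proof.
move=> f0; apply/eqP; rewrite eq_le le_ge0_integral_shift//=.
have := @le_ge0_integral_shift (- t)%R (fun s => f (s + t)%R) (fun s => f0 _).
by under eq_integral do rewrite subrK.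
Qed.

Lemma integral_shift (t : R) (f : R -> \bar R) :
  \int[mu]_s f (s + t)%R = \int[mu]_s f s.
Proof.
rewrite integralE [RHS]integralE.
congr (_ - _).
  by rewrite -[RHS](@ge0_integral_shift t); [|exact: funepos_ge0];
    apply: eq_integral => s _; rewrite !funeposE.
by rewrite -[RHS](@ge0_integral_shift t); [|exact: funeneg_ge0];
  apply: eq_integral => s _; rewrite !funenegE.
Qed.

End integral_translation.

(* Representatives of the elements of L^1(R, X): strongly measurable functions
   (everywhere limits of Borel simple functions, a representative that every
   class has) with integrable norm.  Classes are not formed: the pairing below
   only depends on the class. *)
Section L1.
Variables (R : realType) (k : scalar_kind).
Local Notation K := (scalar_field R k).
Variable X : normedModType K.
Local Notation mu := (@lebesgue_measure R).

Definition simple_function (h : R -> X) := finite_set (range h) /\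
  forall x, measurable (h @^-1` [set x] : set (measurableTypeR R)).

Definition strongly_measurable (h : R -> X) :=
  exists2 phi : nat -> R -> X, forall n, simple_function (phi n) &
    forall s, phi n s @[n --> \oo] --> h s.

Record L1 := MkL1 {
  L1_fun :> R -> X ;
  L1_strongly_measurable : strongly_measurable L1_fun ;
  L1_integrable : (\int[mu]_s (reK `|L1_fun s|)%:E < +oo)%E }.

Let L1_translate_measurable (t : R) (h : L1) :
  strongly_measurable (fun s => h (s - t)).
Proof.
have [phi sphi phih] := L1_strongly_measurable h.
exists (fun n s => phi n (s - t)); last by move=> s; exact: phih.
move=> n; have [fphi mphi] := sphi n; split.
  by apply: sub_finite_set fphi => _ [s _ <-]; exists (s - t).
by move=> x; exact: (@measurable_preimage_shift R (- t) (phi n @^-1` [set x])).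
Qed.

Let L1_translate_integrable (t : R) (h : L1) :
  (\int[mu]_s (reK `|h (s - t)|)%:E < +oo)%E.
Proof.
by rewrite (@integral_shift R (- t) (fun s => (reK `|h s|)%:E)) L1_integrable.
Qed.

(* The operator T(t) = T_0(t) \otimes I: (T(t) h)(s) = h(s - t). *)
Definition L1_translate t h : L1 :=
  MkL1 (L1_translate_measurable t h) (L1_translate_integrable t h).

(* The duality <h, f> = \int <h(s), f(s)> ds; the integral of a complex function
   is taken componentwise. *)
Definition integralK (g : R -> K) : K :=
  mkK (\int[mu]_s reK (g s))%R (\int[mu]_s imK (g s))%R.

Definition pairing (h : L1) (f : BUC (dual X)) : K :=
  integralK (fun s => f s (h s)).

Lemma pairing_translate t h f :
  pairing (L1_translate t h) f = pairing h (Tsun (dual X) t f).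
Proof.
have H (g : R -> R) : (\int[mu]_s g (s + t) = \int[mu]_s g s)%R.
  by rewrite /Rintegral (@integral_shift R t (EFin \o g)).
rewrite /pairing /integralK /=; congr mkK.
  by rewrite -[LHS]H; apply: eq_Rintegral => s _ /=; rewrite addrK.
by rewrite -[LHS]H; apply: eq_Rintegral => s _ /=; rewrite addrK.
Qed.

End L1.

Section sun.
Variables (R : realType) (k : scalar_kind).
Local Notation K := (scalar_field R k).
Variable X : normedModType K.
Local Notation BUCX := (BUC (dual X)).

(* [sun_operators] is a copy of L(BUC(R, X^* )) with the topology in which
   V_i --> V iff <h, V_i f> --> <h, V f> for all h and f. *)
Definition op_pairing (V : blin BUCX BUCX) : {ptws (L1 X * BUCX)%type -> K} :=
  fun hf => pairing hf.1 (V hf.2).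
Definition sun_operators := initial_topology op_pairing.
HB.instance Definition _ := Topological.on sun_operators.

Definition S0sun : set (blin BUCX BUCX) :=
  closure (range (Tsun (dual X)) : set sun_operators).

Definition idempotent_in (S : set (blin BUCX BUCX)) e :=
  S e /\ blin_comp e e = e.

Definition leL (e f : blin BUCX BUCX) := blin_comp e f = e.

Definition minimal_idempotent (S : set (blin BUCX BUCX)) e :=
  idempotent_in S e /\
  forall e', idempotent_in S e' -> leL e' e -> leL e e'.

End sun.

Definition splitting (R : realType) (k : scalar_kind)
    (V : normedModType (scalar_field R k)) (A B : set V) :=
  [/\ submod_closed (mem A : {pred V}) /\ closed A,
      submod_closed (mem B : {pred V}) /\ closed B &
      forall v, exists! ab : V * V, [/\ A ab.1, B ab.2 & v = ab.1 + ab.2]].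

Section almost_periodicity.
Variables (R : realType) (k : scalar_kind).
Variable Z : normedModType (scalar_field R k).

Definition translates (f : Cb Z) : set (Cb Z) :=
  range (fun t => Cb_translate t f).

Definition AP : set (Cb Z) := [set f | precompact (translates f)].

(* Eberlein weakly almost periodic functions: W(R, Z), and [WAP0] is W_0. *)
Definition WAP : set (Cb Z) :=
  [set f | precompact (translates f : set (weak (Cb Z)))].

Definition WAP0 : set (Cb Z) := [set f | WAP f /\ exists t : nat -> R,
  (Cb_translate (t n) f : weak (Cb Z)) @[n --> \oo] --> (0 : weak (Cb Z))].

End almost_periodicity.

Definition BUC_a (R : realType) (k : scalar_kind)
    (X : normedModType (scalar_field R k))
    (P : blin (BUC (dual X)) (BUC (dual X))) : set (BUC (dual X)) := range P.

Definition BUC_0 (R : realType) (k : scalar_kind)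
    (X : normedModType (scalar_field R k))
    (P : blin (BUC (dual X)) (BUC (dual X))) : set (BUC (dual X)) :=
  [set f | P f = 0].

(* Main.v *)
Require Import Defs.
From HB Require Import structures.
From mathcomp Require Import all_boot all_order all_algebra.
From mathcomp Require Import complex.
From mathcomp Require Import all_classical all_reals all_analysis.
From mathcomp Require Import measurable_realfun.
From mathcomp Require Import ring lra.

Set Implicit Arguments.
Unset Strict Implicit.
Unset Printing Implicit Defensive.

Import Order.TTheory GRing.Theory Num.Theory.
Import numFieldNormedType.Exports.

Local Open Scope classical_set_scope.
Local Open Scope ring_scope.

(** Every operator in S_0^sun is a limit f |-> lim_U f(. + t) along an
    ultrafilter U on R, the limit being taken pointwise in the weak-* topology
    of X^*: translates of f share its modulus of continuity, so the limit is
    again in BUC, and dominated convergence along a sequence extracted from U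
    gives the convergence of the pairings with L^1(R, X).  Hence S_0^sun is a
    compact right topological semigroup, and minimal idempotents exist by
    Ellis' theorem.

    If f is almost periodic then T(t) f --> P f in norm along U; since T(t) is
    isometric and commutes with P, |P f - f| = |P T(t) f - T(t) f| --> 0.

    On weakly almost periodic functions S_0^sun is commutative, because
    u |-> lim_U u(s + r) x is a bounded functional on C_b.  If T(t_n) f --> 0
    weakly, a cluster point V of (T(t_n)) kills f, hence V P f = P V f = 0, and
    P = W V P for some W by minimality.

    Uniform continuity of weakly almost periodic f: otherwise there are
    functionals phi_n u = (u(t_n) - u(s_n)) x_n with t_n - s_n --> 0 and
    |phi_n f| bounded below.  The functions phi_n(T(t) f) of t have, along a
    subsequence, a continuous pointwise limit, and by Baire's theorem the
    convergence is uniform on some interval; adding up increments there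
    contradicts the boundedness of f. *)

(** * Ultrafilters and compact semigroups *)

Section ultrafilters.
Implicit Types (I : Type) (T : topologicalType).

Lemma fmap_ultra I J (f : I -> J) (U : set_system I) :
  UltraFilter U -> UltraFilter (f @ U).
Proof.
move=> UU; split; first exact: fmap_proper_filter.
move=> G GG fUG; apply/seteqP; split=> [A GA|//].
have [//|UA] := in_ultra_setVsetC (f @^-1` A) UU.
have : G (A `&` ~` A) by apply: filterI => //; exact: fUG.
by rewrite setICr => /filter_ex[].
Qed.

Lemma compact_ultra_cvg I T (A : set T) (u : I -> T) (U : set_system I) :
  UltraFilter U -> compact A -> (\forall i \near U, A (u i)) ->
  exists2 p, A p & u @ U --> p.
Proof.
move=> UU; rewrite compact_ultra => cA uA.
by have [p [Ap up]] := cA _ (fmap_ultra u UU) uA; exists p.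
Qed.

(** If the preimage of a neighbourhood [A] of [p] were not in [F], then [F] restricted to its
    complement would be proper, and an ultrafilter refining this restriction could not converge to
    [p]. *)
Lemma cvg_ultraP I T (u : I -> T) (F : set_system I) (p : T) : Filter F ->
  (forall U, UltraFilter U -> F `<=` U -> u @ U --> p) -> u @ F --> p.
Proof.
move=> FF H A pA; apply: contrapT => nFA.
have PW : ProperFilter (within (~` (u @^-1` A)) F).
  split; last exact: within_filter.
  by rewrite /within /= => F0; apply: nFA; apply: filterS F0 => i /contrapT.
have [U [UU FU]] := ultraFilterLemma PW.
have UA : U (~` (u @^-1` A)) by apply: FU; exact: withinT.
have FsubU : F `<=` U.
  by move=> B FB; apply: FU; rewrite /within /=; apply: filterS FB.
have : U ((u @^-1` A) `&` ~` (u @^-1` A)).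
  by apply: filterI => //; exact: (H U UU FsubU).
by rewrite setICr => /filter_ex[].
Qed.

(** The preimages under [u] of the neighbourhoods of [p] are nonempty and form a filter base; any
    ultrafilter containing them works. *)
Lemma closure_range_ultra I T (u : I -> T) (p : T) :
  closure (range u) p -> exists2 U : set_system I, UltraFilter U & u @ U --> p.
Proof.
move=> clp; pose F := filter_from (nbhs p) (fun B => u @^-1` B).
have PF : ProperFilter F.
  apply: filter_from_proper.
    apply: filter_from_filter; first by exists setT; exact: filterT.
    by move=> B C pB pC; exists (B `&` C) => //; exact: filterI.
  by move=> B /clp[_ [[i _ <-] Bi]]; exists i.
have [U [UU FU]] := ultraFilterLemma PF.
by exists U => // B pB; apply: FU; exists B.
Qed.

(** Serves both [sun_operators] and [weak]: each topology is initial for a map into a space of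
    functions with pointwise convergence. *)
Lemma initial_ptws_cvgP (S : choiceType) I T (g : S -> {ptws I -> T})
    (F : set_system S) (s : S) : Filter F ->
  F --> (s : initial_topology g) <-> forall i, g x i @[x --> F] --> g s i.
Proof.
move=> FF; split=> [Fs i|gF].
  apply: (@cvg_comp _ _ _ _ (fun x => x i) _ (nbhs (g s))).
    exact: (cvg_trans (cvg_app g Fs) (@initial_continuous _ _ g s)).
  have /cvg_sup/(_ i) gsi : nbhs (g s) --> (g s : {ptws I -> T}).
    exact: cvg_id.
  apply: (cvg_trans (cvg_app (fun x : I -> T => x i) gsi)).
  exact: (@initial_continuous _ _ (fun x : I -> T => x i) (g s)).
move=> A [_ [[B oB <-] Bgs] BA].
have gs : g @ F --> (g s : {ptws I -> T}).
  apply/cvg_sup => i C [D [[E oE <-] Egs] EC].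
  by apply: filterS EC _; apply: gF; apply: open_nbhs_nbhs.
by apply: (filterS BA); apply: gs; apply: open_nbhs_nbhs.
Qed.

Lemma continuous_closure (S T : topologicalType) (f : S -> T)
    (A : set S) (B : set T) :
  continuous f -> (forall x, A x -> B (f x)) ->
  forall x, closure A x -> closure B (f x).
Proof.
move=> cf fAB x clx C /cf/clx[y [Ay Cy]].
by exists (f y); split => //; exact: fAB.
Qed.

End ultrafilters.

(** * Minimal closed subsets and idempotents of compact semigroups *)

Section compact_semigroups.
Variables (T : topologicalType) (op : T -> T -> T) (S : set T).
Hypotheses (T2 : hausdorff_space T) (cS : compact S) (S0 : S !=set0).
Hypothesis opc : forall y, continuous (op^~ y).

(** Zorn's lemma for reverse inclusion on the nonempty closed subsets satisfying [P]; compactness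
    makes the intersection of a nonempty chain nonempty. *)
Lemma minimal_closed_subset (P : set T -> Prop) :
  P S ->
  (forall F : set (set T), F !=set0 -> F `<=` P -> P (\bigcap_(A in F) A)) ->
  exists A, [/\ P A, A !=set0, closed A, A `<=` S &
    forall B, P B -> B !=set0 -> closed B -> B `<=` A -> B = A].
Proof.
move=> PS Pcap.
pose Q A := [/\ P A, A !=set0, closed A & A `<=` S].
have clS : closed S by exact: compact_closed.
have QS : Q S by split.
pose R (A B : {A | Q A}) := `[< sval B `<=` sval A >].
have [| | |[A QA] /= Amin] := @ZL_preorder {A | Q A} (exist _ S QS) R.
- by move=> A; apply/asboolP.
- by move=> A B C /asboolP BA /asboolP AC; apply/asboolP => x /AC/BA.
- move=> C totC; have [[A0 CA0]|C0] := pselect (C !=set0); last first.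
    by exists (exist _ S QS) => A CA; exfalso; apply: C0; exists A.
  pose F := [set sval A | A in C].
  have Fne : F !=set0 by exists (sval A0), A0.
  have FQ : F `<=` Q by move=> _ [A _ <-]; exact: (svalP A).
  (* The chain is a filter base; a cluster point of the filter it generates lies in all its members,
     which are closed. *)
  have PF : ProperFilter (filter_from F id).
    apply: filter_from_proper; last by move=> A /FQ[].
    apply: filter_from_filter => // A B [A' CA' <-] [B' CB' <-].
    have [/asboolP AB|/asboolP BA] := totC _ _ CA' CB'.
      by exists (sval B'); [exists B'|move=> x Bx; split => //; exact: AB].
    by exists (sval A'); [exists A'|move=> x Ax; split => //; exact: BA].
  have [|x [Sx clx]] := @cS _ PF.
    by exists (sval A0); [exists A0|have [_ _ _ ] := svalP A0].
  have Fx : (\bigcap_(A in F) A) x.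
    move=> A FA; have [_ _ clA _] := FQ _ FA.
    by apply: clA => B xB; apply: clx => //; exists A.
  have QF : Q (\bigcap_(A in F) A).
    split; [|by exists x| |].
    - by apply: Pcap => // A /FQ[].
    - by apply: closed_bigI => A /FQ[].
    - by case: Fne => A FA y /(_ _ FA); have [_ _ _] := FQ _ FA; apply.
  exists (exist _ _ QF) => A CA; apply/asboolP => y /= /(_ (sval A)); apply.
  by exists A.
have [PA A0 clA AS] := QA; exists A; split=> // B PB B0 clB BA.
apply/seteqP; split=> //.
have QB : Q B by split=> //; exact: subset_trans AS.
by have /asboolP := Amin (exist _ B QB) (asboolT BA).
Qed.

Lemma closed_right_translate A y :
  A `<=` S -> closed A -> closed [set op x y | x in A].
Proof.
move=> AS clA; apply: compact_closed => //.
have cA : compact A by exact: subclosed_compact cS AS.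
apply: continuous_compact cA.
by apply: continuous_subspaceT => x; exact: opc.
Qed.

End compact_semigroups.

(* Ellis: if A is a minimal closed subsemigroup and a is in A, then A a = A,
   and the x in A with x a = a form a closed subsemigroup, hence a a = a. *)
Lemma compact_semigroup_idempotent (T : topologicalType) (op : T -> T -> T)
    (S : set T) :
  hausdorff_space T -> compact S -> S !=set0 -> associative op ->
  (forall x y, S x -> S y -> S (op x y)) -> (forall y, continuous (op^~ y)) ->
  exists2 e, S e & op e e = e.
Proof.
move=> T2 cS S0 opA opS opc.
pose P (A : set T) := forall x y, A x -> A y -> A (op x y).
have [||A [PA [a Aa] clA AS Amin]] := @minimal_closed_subset _ S T2 cS S0 P.
- exact: opS.
- by move=> F _ FP x y Fx Fy B FB; apply: (FP _ FB); [exact: Fx|exact: Fy].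
have Aae : [set op x a | x in A] = A.
  apply: Amin.
  - move=> _ _ [x Ax <-] [y Ay <-].
    exists (op (op x a) y); last by rewrite !opA.
    by apply: (PA) => //; exact: PA.
  - by exists (op a a), a.
  - exact: (@closed_right_translate _ op S).
  - by move=> _ [x Ax <-]; exact: PA.
have [b Ab ba] : [set op x a | x in A] a by rewrite Aae.
suff E : A `&` [set x | op x a = a] = A.
  have [_ aa] : (A `&` [set x | op x a = a]) a by rewrite E.
  by exists a; [exact: AS|exact: aa].
apply: Amin => [x y [Ax xa] [Ay ya]|||x []//].
- by split; [exact: PA|rewrite /= -opA ya].
- by exists b.
- apply: closedI => //.
  have -> : [set x | op x a = a] = op^~ a @^-1` [set a] by [].
  apply: preimage_closed.
    by move=> x _; exact: opc.
  exact/accessible_closed_set1/hausdorff_accessible.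
Qed.

(** By Ellis, a minimal closed left ideal [A] contains an idempotent [e]. If [f = f e] then [f] lies
    in [A], so [S f = A] by minimality; writing [e = x f] gives [e f = e]. *)
Lemma compact_semigroup_minimal_idempotent (T : topologicalType)
    (op : T -> T -> T) (S : set T) :
  hausdorff_space T -> compact S -> S !=set0 -> associative op ->
  (forall x y, S x -> S y -> S (op x y)) -> (forall y, continuous (op^~ y)) ->
  exists e, [/\ S e, op e e = e &
    forall f, S f -> op f f = f -> op f e = f -> op e f = e].
Proof.
move=> T2 cS S0 opA opS opc.
pose P (A : set T) := forall x y, S x -> A y -> A (op x y).
have [||A [PA A0 clA AS Amin]] := @minimal_closed_subset _ S T2 cS S0 P.
- exact: opS.
- by move=> F _ FP x y Fx Fy B FB; apply: (FP _ FB) => //; exact: Fy.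
have cA : compact A by exact: subclosed_compact cS AS.
have [||e Ae ee] := @compact_semigroup_idempotent _ op A T2 cA A0 opA.
- by move=> x y /AS; exact: PA.
- exact: opc.
exists e; split=> [|//|f Sf ff fe]; first exact: AS.
have Af : A f by rewrite -fe; exact: PA.
have Sfe : [set op x f | x in S] = A.
  apply: Amin.
  - by move=> x _ Sx [y Sy <-]; exists (op x y); [exact: opS|rewrite opA].
  - by exists (op f f), f.
  - by apply: (@closed_right_translate _ op S) => //; exact: compact_closed.
  - by move=> _ [x Sx <-]; exact: PA.
have [x Sx xe] : [set op x f | x in S] e by rewrite Sfe.
by rewrite -xe -opA ff.
Qed.

(** * Real and complex scalars *)

Section scalars.
Variables (R : realType) (k : scalar_kind).
Local Notation K := (scalar_field R k).
Implicit Types (x y : K) (a b : R).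

Lemma mkK_re_im x : mkK (reK x) (imK x) = x.
Proof. by case: k x => //= -[]. Qed.

Lemma reKB x y : reK (x - y) = reK x - reK y.
Proof. by case: k x y => //= -[a b] [c d]. Qed.

Lemma imKB x y : imK (x - y) = imK x - imK y.
Proof. by case: k x y => /= [x y|[a b] [c d]//]; rewrite subrr. Qed.

Lemma reK_mkK a b : reK (mkK a b : K) = a.
Proof. by case: k. Qed.

Lemma reK_nat n : reK (n%:R : K) = n%:R.
Proof. by case: k => //=; rewrite -(rmorph_nat (real_complex R)). Qed.

Lemma reK0 : reK (0 : K) = 0.
Proof. by case: k. Qed.

Lemma reK_ge0 x : 0 <= x -> 0 <= reK x.
Proof. by move=> /ler_reK; case: k x. Qed.

Lemma ler_of_reK x y : 0 <= x -> 0 <= y -> reK x <= reK y -> x <= y.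
Proof. by move=> x0 y0; rewrite -(ler_mkK k) !mkK_reK. Qed.

Lemma reK_mkKM a x : reK (mkK a 0 * x) = a * reK x.
Proof. by case: k x => //= -[c d] /=; rewrite mul0r subr0. Qed.

Lemma normr_reK_le x : `|reK x| <= reK `|x|.
Proof.
case: k x => //= -[a b]; rewrite ?normc_def /= -[leLHS]sqrtr_sqr.
by rewrite ler_sqrt ?addr_ge0 ?sqr_ge0// lerDl sqr_ge0.
Qed.

Lemma normr_imK_le x : `|imK x| <= reK `|x|.
Proof.
case: k x => [x|[a b]] /=; first by rewrite normr0.
rewrite ?normc_def /= -[leLHS]sqrtr_sqr.
by rewrite ler_sqrt ?addr_ge0 ?sqr_ge0// lerDr sqr_ge0.
Qed.

Lemma norm_mkKB_le a b c d :
  `|mkK a b - mkK c d : K| <= mkK (`|a - c| + `|b - d|) 0.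
Proof.
case: k => /=; first by rewrite lerDl.
have -> : (Complex a b - Complex c d : R[i]) =
    Complex (a - c) 0 + Complex 0 (b - d).
  by apply/eqP; rewrite eq_complex /= addr0 add0r !eqxx.
have -> : Complex (`|a - c| + `|b - d|) 0 =
    `|Complex (a - c) 0| + `|Complex 0 (b - d)|.
  rewrite !normc_def /= !expr0n/= addr0 add0r !sqrtr_sqr.
  by apply/eqP; rewrite eq_complex /= addr0 !eqxx.
exact: ler_normD.
Qed.

Lemma reK_gt0 x : 0 < x -> 0 < reK x.
Proof.
move=> x0; rewrite lt_neqAle; apply/andP; split; last first.
  by have := ler_reK (ltW x0); case: k x x0.
apply: contraTneq x0 => x0; apply/negP => /[dup] /ltW /mkK_reK.
by rewrite -x0 => <-; case: k; rewrite ltxx.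
Qed.

Lemma mkK_gt0 a : 0 < a -> 0 < (mkK a 0 : K).
Proof.
move=> a0; rewrite lt_neqAle mkK_ge0 ?(ltW a0)// andbT.
apply: contraTneq a0 => /(congr1 (@reK R k)); rewrite reK_mkK => <-.
by case: k; rewrite ltxx.
Qed.

Lemma cvg_mkK I (F : set_system I) (u v : I -> R) a b : Filter F ->
  u @ F --> a -> v @ F --> b -> (mkK (u i) (v i) : K) @[i --> F] --> mkK a b.
Proof.
move=> FF /cvgrPdist_lt ua /cvgrPdist_lt ub; apply/cvgrPdist_le => e e0.
have e20 : 0 < reK e / 2 by rewrite divr_gt0// reK_gt0.
near=> i; apply: le_trans (norm_mkKB_le _ _ _ _) _.
rewrite -[leRHS]mkK_reK ?(ltW e0)// ler_mkK [leRHS]splitr lerD// ltW//.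
- by near: i; exact: ua.
- by near: i; exact: ub.
Unshelve. all: by end_near. Qed.

Lemma cvg_reK I (F : set_system I) (u : I -> K) (l : K) : Filter F ->
  u @ F --> l -> reK (u i) @[i --> F] --> reK l.
Proof.
move=> FF /cvgrPdist_le ul; apply/cvgrPdist_le => e e0.
near=> i; rewrite -reKB (le_trans (normr_reK_le _))// -[leRHS](reK_mkK e 0).
by apply: ler_reK; near: i; apply: ul; exact: mkK_gt0.
Unshelve. all: by end_near. Qed.

Lemma cvg_imK I (F : set_system I) (u : I -> K) (l : K) : Filter F ->
  u @ F --> l -> imK (u i) @[i --> F] --> imK l.
Proof.
move=> FF /cvgrPdist_le ul; apply/cvgrPdist_le => e e0.
near=> i; rewrite -imKB (le_trans (normr_imK_le _))// -[leRHS](reK_mkK e 0).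
by apply: ler_reK; near: i; apply: ul; exact: mkK_gt0.
Unshelve. all: by end_near. Qed.

Lemma cvg_scalar_unique I (F : set_system I) (u : I -> K) (l l' : K) :
  ProperFilter F -> u @ F --> l -> u @ F --> l' -> l = l'.
Proof. by move=> FF; apply: cvg_unique; exact: (@norm_hausdorff _ K^o). Qed.

(** The real and imaginary parts stay in a compact segment, where ultrafilters converge. *)
Lemma bounded_ultra_cvg I (U : set_system I) (u : I -> K) (M : K) :
  UltraFilter U -> (\forall i \near U, `|u i| <= M) ->
  exists l : K, u @ U --> l.
Proof.
move=> UU uM.
have H (v : I -> R) : (forall i, `|v i| <= reK `|u i|) ->
    exists l : R, v @ U --> l.
  move=> vu; have [|l _ vl] := @compact_ultra_cvg _ _ _ v U UU
    (@segment_compact R (- reK M) (reK M)); last by exists l.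
  apply: filterS uM => i /ler_reK uM /=.
  by rewrite in_itv/= -ler_norml (le_trans (vu i)).
have [a ua] := H _ (fun i => normr_reK_le (u i)).
have [b ub] := H _ (fun i => normr_imK_le (u i)).
exists (mkK a b); have -> : u = fun i => mkK (reK (u i)) (imK (u i)).
  by apply/funext => i; rewrite mkK_re_im.
exact: cvg_mkK.
Qed.

Lemma normr_cvg_le (V : normedModType K) I (F : set_system I) (u : I -> V)
    (l : V) (M : K) : ProperFilter F ->
  u @ F --> l -> (\forall i \near F, `|u i| <= M) -> `|l| <= M.
Proof.
move=> FF /cvgrPdist_le ul uM; apply/ler_addgt0Pr => e e0.
have [i [li ui]] := filter_ex (filterI (ul e e0) uM).
rewrite addrC -[l](subrK (u i)) (le_trans (ler_normD _ _))//.
exact: lerD.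
Qed.

End scalars.

(** * Limits of dominated families *)

Section bounded_operators.
Variables (R : realType) (k : scalar_kind).
Local Notation K := (scalar_field R k).
Variables V W : normedModType K.

Lemma blin_le_norm (f : blin V W) x : `|f x| <= `|f| * `|x|.
Proof.
have [->|x0] := eqVneq x 0; first by rewrite linear0 !normr0 mulr0.
have nx0 : 0 < `|x| by rewrite normr_gt0.
have bf : bounded_on [set x | `|x| <= 1] f.
  have /linear_boundedP/pinfty_ex_gt0[M M0 fM] :=
    continuous_linear_bounded 0 (@blin_continuous _ _ _ _ f 0).
  by exists M => y y1; rewrite (le_trans (fM y))// ler_piMr// ltW.
have := @supnorm_ub _ _ _ [set x : V | `|x| <= 1] _ f (`|x|^-1 *: x) bf.
rewrite /= normrZ normfV normr_id mulVf ?gt_eqF// lexx => /(_ isT).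
by rewrite linearZ/= normrZ normfV normr_id mulrC ler_pdivrMr.
Qed.

Lemma blin_norm_le (f : blin V W) (M : K) : 0 <= M ->
  (forall x, `|f x| <= M * `|x|) -> `|f| <= M.
Proof.
move=> M0 fM; apply: supnorm_le; first by exists 0; rewrite /= normr0.
by move=> x /= x1; rewrite (le_trans (fM x))// ler_piMr.
Qed.

Lemma bounded_linear_blin (f : V -> W) (M : K) : 0 <= M -> linear f ->
  (forall x, `|f x| <= M * `|x|) -> exists g : blin V W, forall x, g x = f x.
Proof.
move=> M0 lf fM; have fP : f \in @blin_pred R k V W.
  rewrite inE; split=> //.
  pose lf' := GRing.isLinear.Build _ _ _ _ f lf.
  pose f' : {linear V -> W} := HB.pack f lf'.
  have : continuous f'; last by [].
  apply: bounded_linear_continuous; apply/linear_boundedP.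
  near=> r => x; rewrite (le_trans (fM x))// ler_wpM2r//.
  near: r; apply: nbhs_pinfty_ge; exact: ger0_real.
by exists (Blin fP).
Unshelve. all: by end_near. Qed.

End bounded_operators.

Section pointwise_operations.
Variables (R : realType) (k : scalar_kind).
Local Notation K := (scalar_field R k).

Lemma blinB (V W : normedModType K) (f g : blin V W) x :
  (f - g) x = f x - g x.
Proof. by []. Qed.

Lemma blin_linearE (V W : normedModType K) (f : blin V W) a x y :
  f (a *: x + y) = a *: f x + f y.
Proof. exact: (linearP f). Qed.

Lemma blin_sub (V W : normedModType K) (f : blin V W) x y :
  f (x - y) = f x - f y.
Proof. exact: (linearB f). Qed.

Lemma blin_ext (V W : normedModType K) (f g : blin V W) :
  (forall x, f x = g x) -> f = g.
Proof. by move=> fg; apply/val_inj/funext. Qed.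

Lemma BUC_ext (Z : normedModType K) (f g : BUC Z) :
  (forall s, f s = g s) -> f = g.
Proof. by move=> fg; apply/val_inj/funext. Qed.

Lemma BUC_dual_ext (X : normedModType K) (f g : BUC (dual X)) :
  (forall s x, f s x = g s x :> K) -> f = g.
Proof. by move=> fg; apply: BUC_ext => s; apply: blin_ext => x; exact: fg. Qed.

Lemma BUCB (Z : normedModType K) (f g : BUC Z) s : (f - g) s = f s - g s.
Proof. by []. Qed.

Lemma BUCDZ (Z : normedModType K) (f g : BUC Z) a s :
  (a *: f + g) s = a *: f s + g s.
Proof. by []. Qed.

Variable V : normedModType K.

Lemma dualB (phi psi : dual V) x : (phi - psi) x = (phi x : K) - psi x.
Proof. by []. Qed.

Lemma dualDZ (phi psi : dual V) a x :
  (a *: phi + psi) x = a * (phi x : K) + psi x.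
Proof. by []. Qed.

Lemma dual0 (phi : dual V) : phi 0 = 0 :> K.
Proof. exact: (linear0 phi). Qed.

Lemma dual_linear (phi : dual V) a x y :
  phi (a *: x + y) = a * (phi x : K) + phi y.
Proof. exact: (linearP phi). Qed.

Lemma dual_scale (phi : dual V) a x : phi (a *: x) = a * (phi x : K).
Proof. by rewrite -[a *: x]addr0 dual_linear dual0 addr0. Qed.

End pointwise_operations.

Section dominated.
Variables (R : realType) (k : scalar_kind).
Local Notation K := (scalar_field R k).
Variable Z : normedModType K.
Implicit Types f g : BUC Z.

Lemma BUC_le_norm f s : `|f s| <= `|f|.
Proof. exact: (supnorm_ub (@BUC_bounded _ _ _ f)). Qed.

Lemma BUC_norm_le f M : (forall s, `|f s| <= M) -> `|f| <= M.
Proof. by move=> fM; apply: supnorm_le; [exists 0|move=> s _; exact: fM]. Qed.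

(* The set of functions dominated by f0 contains the translates of f0 and is
   closed under pointwise weak-* limits. *)
Definition dominated f0 f := (forall s, `|f s| <= `|f0|) /\
  forall (e : K) (d : R),
    (forall s t, `|s - t| < d -> `|f0 s - f0 t| <= e) ->
    forall s t, `|s - t| < d -> `|f s - f t| <= e.

Lemma dominated_Tsun f t : dominated f (Tsun Z t f).
Proof.
split=> [s|e d H s r sr]; first exact: (BUC_le_norm f (s + t)).
by apply: H; rewrite opprD addrACA subrr addr0.
Qed.

Lemma norm_TsunB t f g : `|Tsun Z t f - Tsun Z t g| = `|f - g|.
Proof.
have TN r u : `|Tsun Z r u| <= `|u|.
  by apply: BUC_norm_le; have [] := dominated_Tsun u r.
rewrite -(blin_sub (Tsun Z t)); apply/eqP; rewrite eq_le TN /=.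
(* The inverse translation is a contraction too, which gives the reverse inequality. *)
suff {1}-> : f - g = Tsun Z (- t) (Tsun Z t (f - g)) by exact: TN.
by apply: BUC_ext => s /=; rewrite subrK.
Qed.

Lemma dominated_BUC f0 (g : R -> Z) :
  (forall s, `|g s| <= `|f0|) ->
  (forall (e : K) (d : R),
    (forall s t, `|s - t| < d -> `|f0 s - f0 t| <= e) ->
    forall s t, `|s - t| < d -> `|g s - g t| <= e) ->
  exists2 f, dominated f0 f & forall s, f s = g s.
Proof.
move=> gM gd; have gP : g \in @BUC_pred R k Z.
  rewrite inE; split; last by exists `|f0| => s _; exact: gM.
  apply/unif_continuous_normP => e e0.
  (* Half of [e], because domination transfers non-strict bounds while uniform continuity asks for a
     strict one. *)
  have /unif_continuous_normP/(_ (e / 2)) [|d d0 df] := BUC_unif_continuous f0.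
    by rewrite divr_gt0.
  exists d => // s t st; apply: (@le_lt_trans _ _ (e / 2)).
    by apply: gd st => s' t' /df/ltW.
  by rewrite ltr_pdivrMr// ltr_pMr// ltr1n.
by exists (MkBUC gP).
Qed.

End dominated.

(** Banach-Alaoglu along an ultrafilter: the limit exists at each vector by boundedness, and
    linearity and the bound [M] pass to it. *)
Lemma ultra_dual_cvg (R : realType) (k : scalar_kind)
    (V : normedModType (scalar_field R k)) I (U : set_system I)
    (phi : I -> dual V) (M : scalar_field R k) :
  UltraFilter U -> 0 <= M -> (\forall i \near U, `|phi i| <= M) ->
  exists2 psi : dual V, `|psi| <= M &
    forall v, phi i v @[i --> U] --> (psi v : scalar_field R k).
Proof.
move=> UU M0 phiM.
have phiMv v : \forall i \near U, `|phi i v : scalar_field R k| <= M * `|v|.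
  apply: filterS phiM => i phiiM.
  by rewrite (le_trans (blin_le_norm _ _))// ler_wpM2r.
have /choice[l lP] v : exists l : scalar_field R k, phi i v @[i --> U] --> l.
  exact: bounded_ultra_cvg (phiMv v).
have lM v : `|l v| <= M * `|v|.
  exact: (@normr_cvg_le R k (scalar_field R k)^o _ _ _ _ _ _ (lP v) (phiMv v)).
have llin : linear (l : V -> (scalar_field R k)^o).
  move=> a x y; have c1 := lP (a *: x + y).
  have c2 : phi i (a *: x + y) @[i --> U] -->
      (a *: (l x : (scalar_field R k)^o) + l y : scalar_field R k).
    have -> : (fun i => phi i (a *: x + y)) = (fun i => a *: phi i x + phi i y).
      by apply/funext => i; rewrite linearP.
    by apply: cvgD; [apply: cvgZr; exact: lP|exact: lP].
  exact: (@cvg_scalar_unique R k _ _ _ _ _ _ c1 c2).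
have [psi psiE] :=
  @bounded_linear_blin R k V (scalar_field R k)^o l M M0 llin lM.
exists psi => [|v]; last by rewrite psiE.
by apply: blin_norm_le => // v; rewrite psiE.
Qed.

Section ultra_dominated.
Variables (R : realType) (k : scalar_kind).
Local Notation K := (scalar_field R k).
Variable X : normedModType K.
Local Notation BUCX := (BUC (dual X)).

Lemma ultra_dominated_cvg I (U : set_system I) (F : I -> BUCX) (f0 : BUCX) :
  UltraFilter U -> (\forall i \near U, dominated f0 (F i)) ->
  exists2 g, dominated f0 g & forall s x, F i s x @[i --> U] --> (g s x : K).
Proof.
move=> UU Fd.
have /choice[g gP] : forall s, exists g : dual X, `|g| <= `|f0| /\
    forall x, F i s x @[i --> U] --> (g x : K).
  move=> s; have [|g gM gP] :=
      @ultra_dual_cvg R k X _ _ (F ^~ s) _ UU (normr_ge0 f0).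
    by apply: filterS Fd => i [].
  by exists g.
have [|e d H s t st|f df fg] := @dominated_BUC R k _ f0 g.
- by move=> s; exact: (gP s).1.
(* Domination puts no sign on [e]; the hypothesis at the pair [(s, s)] supplies it. *)
- have e0 : 0 <= e.
    by apply: le_trans (H s s _) => //; rewrite subrr normr0 (le_lt_trans _ st).
  apply: blin_norm_le => // x.
  apply: (@normr_cvg_le R k K^o _ U (fun i => (F i s - F i t) x)).
    rewrite [X in _ --> X]/(g s x - g t x).
    by apply: cvgB; [exact: (gP s).2|exact: (gP t).2].
  apply: filterS Fd => i [_ Fi]; rewrite (le_trans (blin_le_norm _ _))//.
  by rewrite ler_wpM2r//; exact: Fi H _ _ st.
by exists f => // s x; rewrite fg; exact: (gP s).2.
Qed.

End ultra_dominated.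

(** * Convergence of the pairing *)

Section strong_measurability.
Variables (R : realType) (k : scalar_kind).
Local Notation K := (scalar_field R k).
Local Notation mu := (@lebesgue_measure R).
Local Notation mR := (measurableTypeR R).
Variable X : normedModType K.

(** For simple [h] each preimage is a finite union over the values of [h]; continuity of [c] in its
    first variable carries measurability to the limit. *)
Lemma strongly_measurable_comp (h : R -> X) (c : X -> R -> R) :
  strongly_measurable h -> (forall y, measurable_fun [set: mR] (c y)) ->
  (forall s, c y s @[y --> h s] --> c (h s) s) ->
  measurable_fun [set: mR] (fun s => (c (h s) s)%:E).
Proof.
move=> [phi sphi phih] mc cc.
apply: (emeasurable_fun_cvg (fun n s => (c (phi n s) s)%:E)) => [n|s _].
  have [fphi mphi] := sphi n.
  apply/measurable_EFinP => _ B mB; rewrite setTI.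
  have -> : (fun s => c (phi n s) s) @^-1` B =
      \bigcup_(y in range (phi n)) ((phi n @^-1` [set y]) `&` (c y @^-1` B)).
    apply/seteqP; split=> [s /= Bs|s [y _ [/= <- //]]].
    by exists (phi n s).
  apply: fin_bigcup_measurable => // y _; apply: measurableI; first exact: mphi.
  by rewrite -[X in measurable X]setTI; exact: mc.
apply: cvg_EFin; first exact: nearW.
exact: (@cvg_comp _ _ _ (phi ^~ s) (c ^~ s) _ _ _ (phih s) (cc s)).
Qed.

Implicit Types (h : L1 X) (f g : BUC (dual X)).

Lemma BUC_eval_continuous f (x : X) : continuous (fun s => f s x : K).
Proof.
move=> s; apply/cvgrPdist_lt => e e0.
have e20 : 0 < e / (`|x| + 1) by rewrite divr_gt0// ltr_wpDl.
have /unif_continuous_normP/(_ _ e20)[d d0 df] := BUC_unif_continuous f.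
near=> t; apply: (@le_lt_trans _ _ (`|f s - f t| * `|x|)).
  exact: (blin_le_norm (f s - f t)).
apply: (@le_lt_trans _ _ (e / (`|x| + 1) * `|x|)).
  by rewrite ler_wpM2r// ltW// df//; near: t; exact: cvgr_dist_lt.
by rewrite mulrAC ltr_pdivrMr ?ltr_wpDl// ltr_pM2l// ltrDl.
Unshelve. all: by end_near. Qed.

(** [q] stands for [reK] or [imK], so that both components of the pairing are treated at once. *)
Let measurable_eval (q : K -> R) f h : continuous q ->
  measurable_fun [set: mR] (fun s => (q (f s (h s)))%:E).
Proof.
move=> cq.
apply: (@strongly_measurable_comp h (fun y s => q (f s y))).
- exact: L1_strongly_measurable.
- move=> y; apply: continuous_measurable_fun => s.
  by apply: continuous_comp; [exact: BUC_eval_continuous|exact: cq].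
- by move=> s; apply: continuous_comp; [exact: blin_continuous|exact: cq].
Qed.

Let integrable_norm h (M : R) :
  mu.-integrable [set: mR] (fun s => (M%:E * (reK `|h s|)%:E)%E).
Proof.
have mh : measurable_fun [set: mR] (fun s => (reK `|h s|)%:E).
  apply: (@strongly_measurable_comp h (fun y s => reK `|y|)) => //.
  - exact: L1_strongly_measurable.
  - by move=> s; apply: cvg_reK; exact: norm_continuous.
apply: integrableZl => //; apply/integrableP; split => //.
have -> : (fun s : mR => `|(reK `|h s|)%:E|%E) = (fun s => (reK `|h s|)%:E).
  by apply/funext => s; rewrite gee0_abs// lee_fin reK_ge0.
exact: L1_integrable.
Qed.

Lemma integrable_eval (q : K -> R) f h :
  continuous q -> (forall x, `|q x| <= reK `|x|) ->
  mu.-integrable [set: mR] (fun s => (q (f s (h s)))%:E).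
Proof.
move=> cq qle.
apply: (@le_integrable _ mR R mu setT measurableT)
  (integrable_norm h (reK `|f|)).
  exact: measurable_eval.
move=> s _; rewrite -EFinM lee_fin [leRHS]ger0_norm ?mulr_ge0 ?reK_ge0//.
rewrite (le_trans (qle _))// -reK_mkKM mkK_reK//; apply: ler_reK.
by rewrite (le_trans (blin_le_norm _ _))// ler_wpM2r// BUC_le_norm.
Qed.

Let cvg_integral_eval (q : K -> R) (F : nat -> BUC (dual X)) g h (M : R) :
  continuous q -> (forall x, `|q x| <= reK `|x|) ->
  (forall n s, `|F n s| <= mkK M 0) ->
  (forall s, F n s (h s) @[n --> \oo] --> (g s (h s) : K)) ->
  (\int[mu]_s q (F n s (h s)))%R @[n --> \oo] --> (\int[mu]_s q (g s (h s)))%R.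
Proof.
move=> cq qle FM Fg.
have ih := @integrable_norm h M.
have [|||||ig _ ] := @dominated_convergence _ mR R mu setT measurableT
  (fun n s => (q (F n s (h s)))%:E) (fun s => (q (g s (h s)))%:E)
  (fun s => (M%:E * (reK `|h s|)%:E)%E).
- by move=> n; exact: measurable_eval.
- exact: measurable_eval.
- apply/aeW => s _; apply: cvg_EFin; first exact: nearW.
  exact: (@cvg_comp _ _ _ (fun n => F n s (h s) : K) q _ _ _ (Fg s) (cq _)).
- by [].
- apply/aeW => s n _; rewrite /= -EFinM lee_fin (le_trans (qle _))//.
  rewrite -reK_mkKM; apply: ler_reK.
  by rewrite (le_trans (blin_le_norm _ _))// ler_wpM2r.
- move=> cint; rewrite /Rintegral; apply: fine_cvg.
  rewrite fineK//; exact: integrable_fin_num.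
Qed.

Lemma continuous_reK : continuous (@reK R k).
Proof. by move=> l; apply: (@cvg_reK _ _ _ (nbhs l) id l); exact: cvg_id. Qed.

Lemma continuous_imK : continuous (@imK R k).
Proof. by move=> l; apply: (@cvg_imK _ _ _ (nbhs l) id l); exact: cvg_id. Qed.

Lemma cvg_pairing_seq (F : nat -> BUC (dual X)) g h (M : K) :
  (forall n s, `|F n s| <= M) ->
  (forall s, F n s (h s) @[n --> \oo] --> (g s (h s) : K)) ->
  pairing h (F n) @[n --> \oo] --> pairing h g.
Proof.
move=> FM Fg; have M0 : 0 <= M by exact: le_trans (normr_ge0 _) (FM 0%N 0).
rewrite /pairing /integralK; apply: cvg_mkK;
  [apply: (@cvg_integral_eval (@reK R k) F g h (reK M)) => //|
   apply: (@cvg_integral_eval (@imK R k) F g h (reK M)) => //].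
- exact: continuous_reK.
- exact: normr_reK_le.
- by move=> n s; rewrite mkK_reK.
- exact: continuous_imK.
- exact: normr_imK_le.
- by move=> n s; rewrite mkK_reK.
Qed.

End strong_measurability.

Lemma filter_finite I (A : choiceType) (F : set_system I) (D : set A)
    (P : A -> set I) : Filter F -> finite_set D ->
  (forall a, D a -> F (P a)) -> F [set i | forall a, D a -> P a i].
Proof.
move=> FF /finite_fsetP[E ->] FP.
have := @filter_bigI _ _ E P F FF; rewrite /bigcap => H.
by apply: H => a aE; exact: FP.
Qed.

Lemma half_div_le (F : numFieldType) (a c : F) : 0 <= a -> 0 <= c ->
  (a / 2 / (c + 1) + a / 2 / (c + 1)) * c <= a.
Proof.
move=> a0 c0; have c1 : 0 < c + 1 by rewrite ltr_wpDl.
have -> : (a / 2 / (c + 1) + a / 2 / (c + 1)) * c = a * (c / (c + 1)).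
  by field; rewrite gt_eqF.
by rewrite ler_piMr// ler_pdivrMr// mul1r lerDl.
Qed.

Lemma rational_sequence (R : realType) : exists q : nat -> R,
  forall (t d : R), 0 < d -> exists n, `|t - q n| < d.
Proof.
(* Codes that denote no rational are sent to 0, which only repeats a value. *)
exists (fun n => ratr (odflt 0 (unpickle n))) => t d d0.
have [] := @dense_rat R (ball t d).
- by exists t; exact: ballxx.
- exact: ball_open.
- move=> y [ty [r _ ry]]; exists (pickle r); rewrite pickleK /= ry.
  by move: ty; rewrite -ball_normE.
Qed.

Section cvg_pairing.
Variables (R : realType) (k : scalar_kind).
Local Notation K := (scalar_field R k).
Variable X : normedModType K.
Local Notation BUCX := (BUC (dual X)).

(** Dominated convergence needs a sequence. If the pairings stayed [e] away on a set of [U], indices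
    could be picked from that set along which the functions converge at every [(s, h s)]; countably
    many conditions suffice because of the common modulus of continuity and the simple functions
    approximating [h]. *)
Lemma cvg_pairing I (U : set_system I) (F : I -> BUCX) (f0 g : BUCX)
    (h : L1 X) :
  UltraFilter U -> (\forall i \near U, dominated f0 (F i)) -> dominated f0 g ->
  (forall s x, F i s x @[i --> U] --> (g s x : K)) ->
  pairing h (F i) @[i --> U] --> pairing h g.
Proof.
move=> UU Fd gd Fg; apply/cvgrPdist_lt => e e0; apply: contrapT => nU.
have {nU}Ubad : U [set i | ~ `|pairing h g - pairing h (F i)| < e].
  have [//|] := in_ultra_setVsetC
    [set i | `|pairing h g - pairing h (F i)| < e] UU; exact.
have [phi sphi phih] := L1_strongly_measurable h.
have [q qd] := rational_sequence R.
(* A growing finite grid: the first rational times, paired with all values of the first simple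
   functions. Finitely many conditions hold together on a set of [U]. *)
pose A n := (q @` `I_n.+1) `*` (\bigcup_(m in `I_n.+1) range (phi m)).
have finA n : finite_set (A n).
  apply: finite_setX; first exact/finite_image/finite_II.
  by apply: bigcup_finite; [exact: finite_II|move=> m _; have [] := sphi m].
pose good n := [set i | forall a, A n a ->
  `|g a.1 a.2 - F i a.1 a.2 : K| < mkK n.+1%:R^-1 0].
have Ugood n : U (good n).
  apply: filter_finite => // -[s x] _.
  have /cvgrPdist_lt := Fg s x; apply.
  by apply: mkK_gt0; rewrite invr_gt0.
have /choice[i_ i_P] n : exists i, [/\ dominated f0 (F i),
    ~ `|pairing h g - pairing h (F i)| < e & good n i].
  have [i [[? ?] ?]] := filter_ex (filterI (filterI Fd Ubad) (Ugood n)).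
  by exists i.
have /cvgrPdist_lt/(_ e e0)[n _ nP] :
    pairing h (F (i_ n)) @[n --> \oo] --> pairing h g; last first.
  by have [_ + _] := i_P n; apply; exact: nP n (leqnn n).
apply: (@cvg_pairing_seq _ _ _ _ _ _ `|f0|).
  by move=> n s; have [[]] := i_P n.
move=> s; apply/cvgrPdist_lt => r r0.
set x := h s.
pose e1 := r / 3 / 2 / (`|x| + 1).
have x1 : 0 < `|x| + 1 by rewrite ltr_wpDl.
have e10 : 0 < e1 by rewrite !divr_gt0.
have M1 : 0 < `|f0| + 1 by rewrite ltr_wpDl.
have /unif_continuous_normP/(_ _ e10)[d d0 df] := BUC_unif_continuous f0.
have [j sj] := qd s d d0.
have e20 : 0 < r / 3 / 2 / (`|f0| + 1) by rewrite !divr_gt0.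
have /cvgrPdist_lt/(_ _ e20)[m _ mP] := phih s.
pose y := phi m s.
have xy : `|x - y| < r / 3 / 2 / (`|f0| + 1) by exact: (mP m (leqnn m)).
have r30 : 0 < reK (r / 3) by rewrite reK_gt0// divr_gt0.
have mod f : dominated f0 f -> `|f s - f (q j)| <= e1.
  by move=> [_ H]; apply: H sj => ? ? /df/ltW.
near=> n.
have [[FM Fm] _ goodn] := i_P n.
have qy : `|g (q j) y - F (i_ n) (q j) y : K| < r / 3.
  apply: lt_le_trans (goodn (q j, y) _) _.
    split; [exists j|exists m; [|by exists s]] => //=.
      by rewrite ltnS; near: n; exact: nbhs_infty_ge.
    by rewrite ltnS; near: n; exact: nbhs_infty_ge.
  rewrite -[leRHS]mkK_reK ?divr_ge0 ?(ltW r0)// ler_mkK ltW//.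
  by near: n; exact: near_infty_natSinv_lt (PosNum r30).
have gq : `|g (q j)| <= `|f0| by have [] := gd.
set D := fun s => g s - F (i_ n) s.
(* Three errors of size [r / 3]: moving the time [s] to [q j] (modulus of continuity), moving the
   vector [x] to [y] (norm bound), and the error on the grid. *)
have -> : g s x - F (i_ n) s x =
    (D s - D (q j)) x + D (q j) (x - y) + D (q j) y.
  have -> : D (q j) (x - y) = D (q j) x - D (q j) y by rewrite linearB.
  have -> : (D s - D (q j)) x = D s x - D (q j) x by [].
  have tel (V : zmodType) (a b c : V) : a = a - b + (b - c) + c.
    by rewrite addrA !subrK.
  exact: tel.
rewrite (le_lt_trans (ler_normD _ _))//.
have -> : r = r / 3 + r / 3 + r / 3 by field.
rewrite ler_ltD// (le_trans (ler_normD _ _))// lerD//.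
  rewrite (le_trans (blin_le_norm _ _))//.
  have -> : D s - D (q j) = (g s - g (q j)) - (F (i_ n) s - F (i_ n) (q j)).
    by rewrite /D [in LHS]opprD addrACA -opprD.
  apply: (@le_trans _ _ ((e1 + e1) * `|x|)).
    rewrite ler_wpM2r// (le_trans (ler_normB _ _))// lerD// mod//.
  by rewrite half_div_le// divr_ge0// ltW.
rewrite (le_trans (blin_le_norm _ _))//.
apply: (@le_trans _ _ ((`|f0| + `|f0|) * (r / 3 / 2 / (`|f0| + 1)))).
  by rewrite ler_pM// ?(ltW xy)// (le_trans (ler_normB _ _))// lerD.
rewrite mulrDl -mulrDr mulrC.
by rewrite half_div_le// divr_ge0// ltW.
Unshelve. all: by end_near. Qed.

End cvg_pairing.

(** * Separation of points of BUC by the pairing *)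

Section separation.
Variables (R : realType) (k : scalar_kind).
Local Notation K := (scalar_field R k).
Local Notation mu := (@lebesgue_measure R).
Local Notation mR := (measurableTypeR R).
Variable X : normedModType K.

Lemma L1_indicator (a b : R) (x : X) :
  exists h : L1 X, forall s, h s = if s \in `[a, b]%classic then x else 0.
Proof.
pose h (s : R) := if s \in `[a, b]%classic then x else 0.
have mI : measurable (`[a, b]%classic : set mR) by exact: measurable_itv.
have sh : simple_function h.
  split.
    apply: (@sub_finite_set _ _ [set x; 0]); last exact: finite_set2.
    by move=> _ [s _ <-]; rewrite /h; case: ifP => _; [left|right].
  move=> y; have -> : h @^-1` [set y] =
      (if x == y then `[a, b]%classic else set0) `|`
      (if 0 == y then ~` `[a, b]%classic else set0).
    apply/seteqP; split=> s; rewrite /h /=.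
      have [sI|sI] := boolP (s \in _) => <-; rewrite eqxx.
        by left; exact: set_mem.
      by right => /mem_set; exact/negP.
    case=> [|]; case: eqP => // <-; first by move=> /mem_set ->.
    by move=> sI; rewrite memNset.
  by apply: measurableU; case: ifP => // _; exact: measurableC.
have hM : strongly_measurable h.
  by exists (fun=> h) => // s; exact: cvg_cst.
have hI : (\int[mu]_s (reK `|h s|)%:E < +oo)%E.
  have -> : (fun s => (reK `|h s|)%:E) =
      (fun s => (reK `|x|)%:E * (\1_`[a, b] s)%:E)%E.
    apply/funext => s; rewrite -EFinM indicE /h.
    by case: ifP => _; rewrite ?mulr1// mulr0 normr0; case: k.
  rewrite ge0_integralZl//; last 2 first.
  - by apply/measurable_EFinP; exact: measurable_indic.
  - by rewrite lee_fin reK_ge0.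
  rewrite integral_indic// setIT [X in (_ * X)%E]lebesgue_measure_itv /=.
  by case: ifP => _; rewrite ?mule0 ?ltry// -EFinB -EFinM ltry.
by exists (MkL1 hM hI).
Qed.

(** Where the two functions differ, the real part of their difference on a suitable vector stays
    above 1/2 on an interval; the indicator of that interval times this vector detects it. *)
Lemma pairing_separates (g1 g2 : BUC (dual X)) :
  (forall h, pairing h g1 = pairing h g2) -> g1 = g2.
Proof.
move=> g12; apply: BUC_dual_ext => s x.
have [//|c0] := eqVneq (g1 s x : K) (g2 s x).
exfalso; pose D := g1 - g2; pose c : K := D s x.
have {}c0 : c != 0 by rewrite /c /D BUCB dualB subr_eq0.
(* Rescaling turns the nonzero scalar [c] into 1, so that the real part alone sees the
   difference. *)
pose y := c^-1 *: x.
have y1 : D s y = 1 :> K by rewrite dual_scale mulVf.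
have [d d0 Hd] : exists2 d : R, 0 < d &
    forall r, r \in `[s - d, s + d]%classic -> 2^-1 <= reK (D r y : K).
  have : (fun r => reK (D r y : K)) @ s --> (1 : R).
    have -> : 1 = reK (D s y : K) :> R by rewrite y1; case: k.
    by apply: cvg_reK; exact: BUC_eval_continuous.
  move=> /cvgrPdist_le/(_ 2^-1); rewrite invr_gt0 ltr0n => /(_ isT).
  move=> [d /= d0 dP]; exists (d / 2); first by rewrite divr_gt0.
  move=> r; rewrite inE /= in_itv /= => /andP[sr rs].
  have /dP : ball s d r.
    rewrite -ball_normE /= ltr_distlC.
    by apply/andP; split; lra.
  by rewrite ler_distl => /andP[]; lra.
have [h hE] := L1_indicator (s - d) (s + d) y.
have ih (g : BUC (dual X)) :
    mu.-integrable [set: mR] (fun s => (reK (g s (h s) : K))%:E).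
  apply: (@integrable_eval _ _ _ (@reK R k)); first exact: continuous_reK.
  exact: normr_reK_le.
have mI : measurable (`[s - d, s + d]%classic : set mR).
  exact: measurable_itv.
have muI : mu (`[s - d, s + d]%classic : set mR) = (d + d)%:E.
  rewrite [LHS]lebesgue_measure_itv /= lte_fin ifT; last lra.
  by rewrite -EFinB; congr EFin; lra.
have bI (f : R -> R) (M : R) : continuous f -> (forall r, `|f r| <= M) ->
    mu.-integrable (`[s - d, s + d]%classic : set mR) (EFin \o f).
  move=> cf fM; apply: measurable_bounded_integrable => //.
  - by rewrite [X in (X < _)%E]muI ltry.
  - have mf : measurable_fun [set: mR] f by exact: continuous_measurable_fun.
    by apply: (measurable_funS _ _ mf).
  - exists M; split; first exact: num_real.
    by move=> N /ltW MN r _; rewrite /= (le_trans (fM r)).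
have := congr1 (@reK R k) (g12 h); rewrite /pairing /integralK !reK_mkK.
move=> /eqP; rewrite -subr_eq0 -RintegralB//; [|exact: ih|exact: ih].
apply/negP; rewrite gt_eqF//.
have -> : (fun r => reK (g1 r (h r) : K) - reK (g2 r (h r) : K)) =
    (fun r => reK (D r y : K)) \_ `[s - d, s + d]%classic.
  apply/funext => r; rewrite -reKB patchE hE.
  by case: ifP => _; rewrite ?BUCB ?dualB// !dual0 subrr reK0.
rewrite -Rintegral_mkcond.
apply: (@lt_le_trans _ _ (\int[mu]_(r in `[(s - d)%R, s + d]) (2^-1 : R))%R).
  by rewrite Rintegral_cst// [X in fine X]muI /= mulr_gt0 ?invr_gt0 ?addr_gt0.
apply: le_Rintegral => //.
- by apply: (bI _ 2^-1) => [t|_]; [exact: cvg_cst|rewrite ger0_norm].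
- apply: (bI _ (reK (`|D| * `|y|))) => [t|t].
    by apply: cvg_reK; exact: BUC_eval_continuous.
  rewrite (le_trans (normr_reK_le _))//; apply: ler_reK.
  by rewrite (le_trans (blin_le_norm _ _))// ler_wpM2r// BUC_le_norm.
- by move=> r rI; apply: Hd; exact: mem_set.
Qed.

End separation.

(** * The semigroup of sun operators *)

Section sun_semigroup.
Variables (R : realType) (k : scalar_kind).
Local Notation K := (scalar_field R k).
Variable X : normedModType K.
Local Notation BUCX := (BUC (dual X)).
Local Notation op := (blin BUCX BUCX).
Local Notation sun := (@sun_operators R k X).
Local Notation comp := (@blin_comp R k BUCX BUCX BUCX).
Implicit Types V W : op.

Lemma sun_cvgP I (F : set_system I) (W : I -> op) V : Filter F ->
  (W : I -> sun) @ F --> (V : sun) <->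
  forall h f, pairing h (W i f) @[i --> F] --> pairing h (V f).
Proof.
move=> FF; split=> [WV h f|WV].
  exact: (@initial_ptws_cvgP _ _ _ (@op_pairing R k X) _ V _).1 WV (h, f).
apply: (@initial_ptws_cvgP _ _ _ (@op_pairing R k X) _ V _).2 => -[h f].
exact: WV.
Qed.

Lemma continuous_sun_pairing V h f :
  pairing h ((W : op) f) @[W --> (V : sun)] --> pairing h (V f).
Proof.
have FV : Filter (nbhs (V : sun)) by exact: nbhs_filter.
exact: (@sun_cvgP _ _ id V FV).1.
Qed.

Lemma sun_hausdorff : hausdorff_space sun.
Proof.
move=> V W; rewrite cluster_cvgE => -[G GG [GW VG]].
apply: blin_ext => f; apply: pairing_separates => h.
have FG : Filter G by exact: filter_filter.
have cW := (@sun_cvgP _ G id W FG).1 GW h f.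
have cV := (@sun_cvgP _ G id V FG).1 VG h f.
exact: (@cvg_scalar_unique R k _ _ _ _ _ _ cV cW).
Qed.

(** The source of compactness: pointwise weak-* limits along [U] define a linear contraction, and
    [cvg_pairing] upgrades them to convergence in the operator topology. *)
Lemma ultra_operator_cvg I (U : set_system I) (W : I -> op) :
  UltraFilter U -> (\forall i \near U, forall f, dominated f (W i f)) ->
  exists V, [/\ forall f, dominated f (V f),
    forall f s x, W i f s x @[i --> U] --> (V f s x : K) &
    (W : I -> sun) @ U --> (V : sun)].
Proof.
move=> UU Wd.
have /choice[v vP] : forall f, exists g : BUCX, dominated f g /\
    forall s x, W i f s x @[i --> U] --> (g s x : K).
  move=> f; have [|g gd Wg] :=
      @ultra_dominated_cvg _ _ _ _ _ (fun i => W i f) f UU.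
    by apply: filterS Wd => i; exact.
  by exists g.
have vlin : linear v.
  move=> a f g; apply: BUC_dual_ext => s x.
  have [_ /(_ s x) c1] := vP (a *: f + g).
  rewrite BUCDZ dualDZ.
  have c2 : W i (a *: f + g) s x @[i --> U] --> a * (v f s x : K) + v g s x.
    have -> : (fun i => W i (a *: f + g) s x : K) =
        (fun i => a * (W i f s x : K) + W i g s x).
      by apply/funext => i; rewrite blin_linearE BUCDZ dualDZ.
    by apply: cvgD; [apply: cvgMr; exact: (vP f).2|exact: (vP g).2].
  exact: (@cvg_scalar_unique R k _ _ _ _ _ _ c1 c2).
have [|V VE] := @bounded_linear_blin _ _ _ _ v 1 ler01 vlin.
  by move=> f; rewrite mul1r; apply: BUC_norm_le; have [[]] := vP f.
exists V; split=> [f|f s x|]; rewrite ?VE; [exact: (vP f).1|exact: (vP f).2|].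
apply/sun_cvgP => h f; rewrite VE; apply: (@cvg_pairing _ _ _ _ _ _ f) => //.
- by apply: filterS Wd => i; exact.
- exact: (vP f).1.
- exact: (vP f).2.
Qed.

(** A closure point is a limit of translations along some ultrafilter; as the topology is Hausdorff,
    it coincides with the pointwise limit operator. *)
Lemma S0sun_ultra V : S0sun V -> exists U : set_system R, [/\ UltraFilter U,
  forall f, dominated f (V f) &
  forall (f : BUCX) s x, f (s + t) x @[t --> U] --> (V f s x : K)].
Proof.
move=> /closure_range_ultra[U UU cV].
have [|W [Wd Wc cW]] := @ultra_operator_cvg _ _ (Tsun (dual X)) UU.
  by apply: nearW => t f; exact: dominated_Tsun.
by exists U; have -> : V = W := cvg_unique sun_hausdorff cV cW.
Qed.

Lemma ultra_S0sun (U : set_system R) : UltraFilter U ->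
  exists2 V, S0sun V &
    forall (f : BUCX) s x, f (s + t) x @[t --> U] --> (V f s x : K).
Proof.
move=> UU.
have [|V [Vd Vc cV]] := @ultra_operator_cvg _ _ (Tsun (dual X)) UU.
  by apply: nearW => t f; exact: dominated_Tsun.
exists V => // B /cV UB.
have [t Bt] : exists t, B (Tsun (dual X) t) by exact: (@filter_ex _ U) UB.
by exists (Tsun (dual X) t); split => //; exists t.
Qed.

Lemma S0sun_neq0 : @S0sun R k X !=set0.
Proof. by exists (Tsun (dual X) 0); apply: subset_closure; exists 0. Qed.

(** An ultrafilter on these operators is itself a dominated family, indexed by the identity, hence
    converges; the closure retains the limit. *)
Lemma S0sun_compact : compact (@S0sun R k X : set sun).
Proof.
rewrite compact_ultra => F UF FS.
have [|V [_ _ cV]] := @ultra_operator_cvg _ F id UF.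
  by apply: filterS FS => W /S0sun_ultra[U []].
exists V; split=> //.
apply: (@closed_cvg _ sun F _ id (@S0sun R k X)) cV => //.
exact: closed_closure.
Qed.

Lemma blin_compA : associative comp.
Proof. by move=> U V W; exact: blin_ext. Qed.

Lemma continuous_blin_compl W :
  continuous (comp^~ W : sun -> sun).
Proof.
move=> V; apply: (@sun_cvgP _ (nbhs (V : sun)) _ _ (nbhs_filter _)).2 => h f /=.
exact: continuous_sun_pairing.
Qed.

(** [pairing_translate] moves the outer translation onto [h], which leaves another coordinate of the
    same topology. *)
Lemma continuous_Tsun_comp t :
  continuous (comp (Tsun (dual X) t) : sun -> sun).
Proof.
move=> V; apply: (@sun_cvgP _ (nbhs (V : sun)) _ _ (nbhs_filter _)).2 => h f /=.
rewrite -pairing_translate.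
under eq_fun do rewrite -pairing_translate.
exact: continuous_sun_pairing.
Qed.

(** Two closure arguments in a row: [V] is approximated by translations with [W] fixed, then [W] is
    approximated with the translation fixed. *)
Lemma S0sun_comp V W : S0sun V -> S0sun W -> S0sun (blin_comp V W).
Proof.
move=> SV SW.
have S2 : closure (@S0sun R k X : set sun) `<=` @S0sun R k X.
  exact: closed_closure.
apply: S2; apply: continuous_closure (@continuous_blin_compl W) _ _ SV.
move=> _ [t _ <-].
apply: continuous_closure (@continuous_Tsun_comp t) _ _ SW.
move=> _ [r _ <-]; exists (r + t) => //; apply: blin_ext => f.
by apply: BUC_ext => s /=; rewrite addrA addrAC.
Qed.

Lemma minimal_idempotent_exists : exists P, minimal_idempotent (@S0sun R k X) P.
Proof.
have [P [SP PP Pmin]] := compact_semigroup_minimal_idempotent sun_hausdorff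
  S0sun_compact S0sun_neq0 blin_compA S0sun_comp continuous_blin_compl.
by exists P; split=> // W [SW WW]; exact: Pmin.
Qed.

(* P is recovered from any element of the left ideal S V P: this ideal contains
   an idempotent W V P, which lies below P. *)
Lemma minimal_idempotent_recover P V :
  minimal_idempotent (@S0sun R k X) P -> S0sun V ->
  exists2 W, S0sun W & P = blin_comp W (blin_comp V P).
Proof.
move=> [[SP PP] Pmin] SV.
pose VP := blin_comp V P.
have SVP : S0sun VP by exact: S0sun_comp.
pose L := [set blin_comp W VP | W in @S0sun R k X].
have [|||_ [W SW <-] ee] := @compact_semigroup_idempotent sun comp L
  sun_hausdorff _ _ blin_compA _ continuous_blin_compl.
- apply: subclosed_compact S0sun_compact _.
    apply: (@closed_right_translate sun comp (@S0sun R k X)) => //.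
    - exact: sun_hausdorff.
    - exact: S0sun_compact.
    - exact: continuous_blin_compl.
    - exact: closed_closure.
  by move=> _ [W SW <-]; exact: S0sun_comp.
- by have [W SW] := S0sun_neq0; exists (blin_comp W VP), W.
- move=> _ _ [W SW <-] [W' SW' <-]; exists (blin_comp (blin_comp W VP) W').
    by apply: S0sun_comp => //; exact: S0sun_comp.
  by rewrite !blin_compA.
set e := blin_comp W VP in ee.
have Se : S0sun e by exact: S0sun_comp.
have eP : leL e P by rewrite /leL /e /VP -!blin_compA PP.
have Pe : leL P e by exact: Pmin.
(* [Pe] says [P e = P], that is [P = (P W)(V P)]. *)
exists (blin_comp P W); first exact: S0sun_comp.
by rewrite -blin_compA -/VP -/e.
Qed.

End sun_semigroup.

(** * Almost periodic functions *)

Section bounded_continuous.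
Variables (R : realType) (k : scalar_kind).
Local Notation K := (scalar_field R k).
Variable Z : normedModType K.
Implicit Types (f g : Cb Z) (s t : R).

Lemma Cb_le_norm f s : `|f s| <= `|f|.
Proof. exact: (supnorm_ub (@Cb_bounded _ _ _ f)). Qed.

Lemma Cb_ext f g : (forall s, f s = g s) -> f = g.
Proof. by move=> fg; apply/val_inj/funext. Qed.

Lemma norm_BUC_CbB (f g : BUC Z) : `|BUC_Cb f - BUC_Cb g| = `|f - g|.
Proof. by []. Qed.

Lemma unif_continuous_BUC_Cb f : unif_continuous f ->
  exists g : BUC Z, f = BUC_Cb g.
Proof.
move=> uf; have fP : (f : R -> Z) \in @BUC_pred R k Z.
  by rewrite inE; split => //; exact: Cb_bounded.
by exists (MkBUC fP); exact: Cb_ext.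
Qed.

Lemma not_unif_continuous_seq (f : R -> Z) : ~ unif_continuous f ->
  exists (e : K) (s t : nat -> R), 0 < e /\
    forall n, `|t n - s n| < n.+1%:R^-1 /\ ~ `|f (t n) - f (s n)| < e.
Proof.
move=> /unif_continuous_normP/existsNP[e /not_implyP[e0 nd]].
have /choice[st stP] n : exists st : R * R,
    `|st.2 - st.1| < n.+1%:R^-1 /\ ~ `|f st.2 - f st.1| < e.
  apply: contrapT => H; apply: nd; exists n.+1%:R^-1; first by rewrite invr_gt0.
  by move=> s t st; apply: contrapT => nfe; apply: H; exists (t, s).
by exists e, (fun n => (st n).1), (fun n => (st n).2).
Qed.

End bounded_continuous.

Section almost_periodic.
Variables (R : realType) (k : scalar_kind).
Local Notation K := (scalar_field R k).
Variable Z : normedModType K.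

Lemma AP_ultra_cvg (f : Cb Z) I (U : set_system I) (t : I -> R) :
  AP f -> UltraFilter U ->
  exists g : Cb Z, Cb_translate (t i) f @[i --> U] --> g.
Proof.
rewrite /AP /= precompactE => cf UU.
have [|g _ fg] :=
    @compact_ultra_cvg _ _ _ (fun i => Cb_translate (t i) f) U UU cf.
  by apply: nearW => i; apply: subset_closure; exists (t i).
by exists g.
Qed.

(** Along bad pairs [s n], [t n], the translates by [s n] would converge uniformly to some [g] along
    an ultrafilter. As [t n - s n] tends to 0, continuity of [g] at 0 would bring [f (t n)] and
    [f (s n)] together. *)
Lemma AP_unif_continuous (f : Cb Z) : AP f -> unif_continuous f.
Proof.
move=> fAP; apply: contrapT => /not_unif_continuous_seq[e [s [t [e0 st]]]].
have [V [UV ooV]] := ultraFilterLemma eventually_filter.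
have [g /cvgrPdist_lt fg] := AP_ultra_cvg s fAP UV.
have g0 : g (t n - s n) @[n --> V] --> g 0.
  have ts0 : t n - s n @[n --> V] --> (0 : R).
    apply/cvgrPdist_lt => r r0; apply: ooV.
    near=> n; rewrite sub0r normrN; have [+ _] := st n => /lt_trans; apply.
    by near: n; exact: (near_infty_natSinv_lt (PosNum r0)).
  exact: (@cvg_comp _ _ _ (fun n => t n - s n) g _ _ _ ts0
    (@Cb_continuous _ _ _ g 0)).
have e30 : 0 < e / 3 by rewrite divr_gt0.
have [n [fgn gn]] := filter_ex (filterI (fg _ e30)
  ((cvgrPdist_lt _ _).1 g0 _ e30)).
have [_ []] := st n.
have H r : `|g r - f (r + s n)| < e / 3.
  exact: (le_lt_trans (Cb_le_norm (g - Cb_translate (s n) f) r)).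
have tel (a b c d : Z) : a - b = (c - b) - (d - a) - (c - d).
  by rewrite !opprB -addrA [a - d + _]addrA subrK addrC addrA subrK.
rewrite (tel _ _ (g 0) (g (t n - s n))).
have := H 0; have := H (t n - s n); rewrite subrK add0r => H1 H0.
have -> : e = e / 3 + e / 3 + e / 3 by field.
rewrite (le_lt_trans (ler_normB _ _))// ltrD// (le_lt_trans (ler_normB _ _))//.
by rewrite ltrD.
Unshelve. all: by end_near. Qed.

End almost_periodic.

(** * Weakly almost periodic functions *)

Section weakly_almost_periodic.
Variables (R : realType) (k : scalar_kind).
Local Notation K := (scalar_field R k).
Variable X : normedModType K.
Local Notation CbX := (Cb (dual X)).
Implicit Types (f g u : CbX) (s t : R) (x : X) (phi : dual CbX).

Lemma CbDZ (Z : normedModType K) (f g : Cb Z) a s :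
  (a *: f + g) s = a *: f s + g s.
Proof. by []. Qed.

Lemma Cb_dual_ext f g : (forall s x, f s x = g s x :> K) -> f = g.
Proof. by move=> fg; apply: Cb_ext => s; apply: blin_ext => x; exact: fg. Qed.

Lemma Cb_eval s x : exists2 phi : dual CbX, `|phi| <= `|x| &
  forall u, phi u = u s x :> K.
Proof.
have evlin : linear (fun u : CbX => u s x : K^o).
  by move=> a u v; rewrite CbDZ dualDZ.
have evM u : `|u s x : K| <= `|x| * `|u|.
  by rewrite (le_trans (blin_le_norm _ _))// mulrC ler_wpM2l// Cb_le_norm.
have [phi phiE] := @bounded_linear_blin R k CbX K^o _ _ (normr_ge0 x) evlin evM.
by exists phi => //; apply: blin_norm_le => // u; rewrite phiE.
Qed.

Lemma WAP_ultra_cvg f I (U : set_system I) (t : I -> R) :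
  WAP f -> UltraFilter U ->
  exists g, forall phi, phi (Cb_translate (t i) f) @[i --> U] --> (phi g : K).
Proof.
rewrite /WAP /= precompactE => cf UU.
have [|g _ fg] := @compact_ultra_cvg _ (weak CbX) _
    (fun i => Cb_translate (t i) f) U UU cf.
  by apply: nearW => i; apply: subset_closure; exists (t i).
exists g => phi.
have FU : Filter ((fun i => Cb_translate (t i) f) @ U) by exact: fmap_filter.
exact: (@initial_ptws_cvgP _ _ _ (@eval_dual R k CbX) _ g FU).1 fg phi.
Qed.

Lemma Cb_eval_continuous f x : continuous (fun s => f s x : K).
Proof.
move=> s; apply: (@cvg_comp _ _ _ f (fun phi : dual X => phi x : K)).
  exact: Cb_continuous.
apply/cvgrPdist_lt => e e0.
have e20 : 0 < e / (`|x| + 1) by rewrite divr_gt0// ltr_wpDl.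
have /cvgrPdist_lt/(_ _ e20) : id @ f s --> f s by exact: cvg_id.
apply: filterS => psi fpsi; rewrite -dualB (le_lt_trans (blin_le_norm _ _))//.
apply: (@le_lt_trans _ _ (e / (`|x| + 1) * `|x|)).
  by rewrite ler_wpM2r// ltW.
by rewrite mulrAC ltr_pdivrMr ?ltr_wpDl// ltr_pM2l// ltrDl.
Qed.

(** Weak precompactness gives a weak limit along every ultrafilter converging to [t]; point
    evaluations identify it as the translate by [t]. *)
Lemma WAP_weakly_continuous f phi : WAP f ->
  continuous (fun t => phi (Cb_translate t f) : K).
Proof.
move=> fW t; apply: cvg_ultraP => U UU tU.
have [g fg] := WAP_ultra_cvg id fW UU.
suff <- : g = Cb_translate t f by exact: fg.
apply: Cb_dual_ext => s x; have [psi _ psiE] := Cb_eval s x.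
have c1 := fg psi; rewrite psiE in c1.
apply: (@cvg_scalar_unique R k _ _ _ _ _ _ c1).
have -> : (fun i => psi (Cb_translate i f) : K) = (fun r => f (s + r) x).
  by apply/funext => r; rewrite psiE.
apply: cvg_trans (cvg_app _ tU) _.
apply: (@cvg_comp _ _ _ (fun r => s + r) (fun r => f r x : K) _ (nbhs (s + t))).
  by apply: cvgD; [exact: cvg_cst|exact: cvg_id].
exact: (@Cb_eval_continuous f x (s + t)).
Qed.

Lemma dual_norm_witness (psi : dual X) (e : K) : 0 <= e -> ~ `|psi| <= e ->
  exists2 x, `|x| <= 1 & ~ `|psi x : K| <= e.
Proof.
move=> e0 npsi; apply: contrapT => H; apply: npsi.
apply: supnorm_le; first by exists 0; rewrite /= normr0.
by move=> x x1; apply: contrapT => nx; apply: H; exists x.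
Qed.

Lemma continuous_eq_dense (c c' : R -> K) (q : nat -> R) :
  (forall (t d : R), 0 < d -> exists n, `|t - q n| < d) ->
  continuous c -> continuous c' -> (forall n, c (q n) = c' (q n)) ->
  forall t, c t = c' t.
Proof.
move=> qd cc cc' cq t; apply/eqP; rewrite -subr_eq0 -normr_le0.
apply/ler_addgt0Pr => e e0; rewrite add0r.
have e20 : 0 < e / 2 by rewrite divr_gt0.
have := filterI ((cvgrPdist_le _ _).1 (cc t) _ e20)
  ((cvgrPdist_le _ _).1 (cc' t) _ e20).
move=> [d /= d0 dP]; have [n tn] := qd t d d0.
have [|/= H H'] := dP (q n); first exact: tn.
rewrite -[c t](subrK (c (q n))) -addrA (le_trans (ler_normD _ _))//.
by rewrite [leRHS]splitr lerD// cq distrC.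
Qed.

(* Baire: the closed sets on which |c - c_n| <= e for all n >= m cover R. *)
Lemma pointwise_cvg_uniform_ball (c : R -> K) (ck : nat -> R -> K) (e : K)
    (r : R) :
  continuous c -> (forall n, continuous (ck n)) ->
  (forall t, ck n t @[n --> \oo] --> c t) -> 0 < e -> 0 < r ->
  exists t0 d m, 0 < d /\ forall t n, `|t - t0| < d -> (m <= n)%N ->
    `|t| < r /\ `|c t - ck n t| <= e.
Proof.
move=> cc cck cvg_ck e0 r0.
pose A m := [set t | forall n, (m <= n)%N -> reK `|c t - ck n t| <= reK e].
have clA m : closed (A m).
  have -> : A m = \bigcap_(n in [set n | (m <= n)%N])
      ((fun t => reK `|c t - ck n t|) @^-1` [set y : R | y <= reK e]).
    by apply/seteqP; split=> t At n; exact: At.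
  apply: closed_bigI => n _; apply: preimage_closed; last exact: closed_le.
  move=> t _; apply: cvg_reK; apply: (@cvg_norm _ K^o).
  by apply: (@cvgB _ K^o); [exact: cc|exact: cck].
(* Cutting with a ball of radius [r / 2] keeps the interval that Baire's theorem provides inside
   [|t| < r]. *)
pose B m := ~` (A m `&` closed_ball (0 : R^o) (r / 2)).
have [m nB] : exists m, ~ dense (B m : set R^o).
  apply: contrapT => nB.
  have oB m : open (B m : set R^o) /\ dense (B m : set R^o).
    split.
      by apply: closed_openC; apply: closedI => //; exact: closed_ball_closed.
    by apply: contrapT => H; apply: nB; exists m.
  have := @Baire R R^o B oB.
  move=> /(_ (ball (0 : R^o) (r / 2)))[||t [tr Bt]].
  - by exists 0; apply: ballxx; rewrite divr_gt0.
  - exact: ball_open.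
  have /cvgrPdist_le/(_ e e0)[n _ nP] := cvg_ck t.
  apply: (Bt n I); split; first by move=> j nj; apply/ler_reK/nP.
  by apply: subset_closed_ball.
have [D [[t0 [oD Dt0]] DB]] := denseNE nB.
have [d /= d0 dD] := open_nbhs_nbhs (conj oD Dt0).
exists t0, d, m; split=> // t n t0d mn.
have /dD Dt : ball t0 d t by rewrite -ball_normE /= distrC.
have : ~ B m t by move=> Bt; have : (D `&` B m) t by []; rewrite DB.
move=> /contrapT[At].
rewrite closed_ballE ?divr_gt0// /closed_ball_ /= sub0r normrN => tr.
split; first by rewrite (le_lt_trans tr)// ltr_pdivrMr// ltr_pMr// ltr1n.
by apply: ler_of_reK; [|exact: ltW|exact: At].
Qed.

End weakly_almost_periodic.

(** * Uniform continuity of weakly almost periodic functions *)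

Section WAP_unif_continuous.
Variables (R : realType) (k : scalar_kind).
Local Notation K := (scalar_field R k).
Variable X : normedModType K.
Local Notation CbX := (Cb (dual X)).

Lemma increment_functional (s t : R) (x : X) : `|x| <= 1 ->
  exists2 phi : dual CbX, `|phi| <= 2 & forall u, phi u = (u t - u s) x :> K.
Proof.
move=> x1.
have [ps psM psE] := Cb_eval s x; have [pt ptM ptE] := Cb_eval t x.
exists (pt - ps) => [|u]; last by rewrite !dualB psE ptE.
rewrite (le_trans (ler_normB _ _))// [leRHS]splitr.
have -> : 2 / 2 = 1 :> K by field.
by rewrite lerD// (le_trans _ x1).
Qed.

(* Telescoping: c is almost constant near t0, so the increments of a along an
   arithmetic progression with small step all add up. *)
Lemma bounded_increments (a : R -> K) (M c e : K) (t0 d h : R) (n : nat) :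
  (forall t, `|a t| <= M) -> 0 <= e -> n%:R * `|h| < d ->
  (forall t, `|t - t0| < d -> `|c - (a (t + h) - a t)| <= e) ->
  n%:R * `|c| <= M + M + n%:R * e.
Proof.
move=> aM e0 nh ach.
have H m : (m <= n)%N -> `|m%:R * c - (a (t0 + m%:R * h) - a t0)| <= m%:R * e.
  elim: m => [|m IH] mn; first by rewrite !mul0r addr0 subrr subr0 normr0.
  have -> : m.+1%:R * c - (a (t0 + m.+1%:R * h) - a t0) =
      (m%:R * c - (a (t0 + m%:R * h) - a t0)) +
      (c - (a (t0 + m%:R * h + h) - a (t0 + m%:R * h))).
    have -> : t0 + m.+1%:R * h = t0 + m%:R * h + h.
      by rewrite -natr1 mulrDl mul1r addrA.
    by rewrite -natr1; ring.
  rewrite (le_trans (ler_normD _ _))// -[m.+1%:R]natr1 mulrDl mul1r lerD//.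
    by apply: IH; exact: ltnW.
  apply: ach; rewrite addrC addKr normrM normr_nat.
  by rewrite (le_lt_trans _ nh)// ler_wpM2r// ler_nat ltnW.
have -> : n%:R * `|c| = `|n%:R * c| by rewrite normrM normr_nat.
rewrite -[n%:R * c](subrK (a (t0 + n%:R * h) - a t0)) addrC.
rewrite (le_trans (ler_normD _ _))// lerD ?H//.
by rewrite (le_trans (ler_normB _ _))// lerD.
Qed.

Lemma WAP_unif_continuous (f : CbX) : WAP f -> unif_continuous f.
Proof.
move=> fW; apply: contrapT => /not_unif_continuous_seq[e [s [t [e0 st]]]].
have e20 : 0 < e / 2 by rewrite divr_gt0.
have /choice[x xP] n : exists x : X,
    `|x| <= 1 /\ ~ `|(f (t n) - f (s n)) x : K| <= e / 2.
  have [|x x1 xe] := @dual_norm_witness _ _ _ (f (t n) - f (s n)) _ (ltW e20).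
    move=> H; have [_] := st n; apply; rewrite (le_lt_trans H)//.
    by rewrite ltr_pdivrMr// ltr_pMr// ltr1n.
  by exists x.
have /choice[phi phiP] n : exists phi : dual CbX, `|phi| <= 2 /\
    forall u, phi u = (u (t n) - u (s n)) (x n) :> K.
  by have [phi] := increment_functional (s n) (t n) (xP n).1; exists phi.
pose C (psi : dual CbX) (r : R) : K := psi (Cb_translate r f).
have cC psi : continuous (C psi) by exact: WAP_weakly_continuous.
have [V [UV ooV]] := ultraFilterLemma eventually_filter.
have [|psi _ psiP] := @ultra_dual_cvg _ _ _ _ _ phi 2 UV (ler0n _ 2).
  by apply: nearW => n; exact: (phiP n).1.
have [q qd] := rational_sequence R.
(* A subsequence converging on the rationals converges everywhere, since its
   limits along ultrafilters are continuous. *)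
have /choice[j jP] m : exists n, (m <= n)%N /\
    forall i, (i <= m)%N -> `|C psi (q i) - C (phi n) (q i)| < mkK m.+1%:R^-1 0.
  apply: (@filter_ex _ V); apply: filterI; first by apply: ooV; exists m.
  have H : V [set n | forall i, `I_m.+1 i ->
      [set n | `|C psi (q i) - C (phi n) (q i)| < mkK m.+1%:R^-1 0] n].
    apply: filter_finite; first exact: finite_II.
    move=> i _; have /cvgrPdist_lt := psiP (Cb_translate (q i) f); apply.
    by apply: mkK_gt0; rewrite invr_gt0.
  by apply: filterS H => n Hn i im; exact: Hn.
have jC r : C (phi (j n)) r @[n --> \oo] --> C psi r.
  apply: cvg_ultraP => U UU ooU.
  have [|psi' _ psi'P] := @ultra_dual_cvg _ _ _ _ _ (phi \o j) 2 UU (ler0n _ 2).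
    by apply: nearW => n; exact: (phiP _).1.
  suff -> : C psi r = C psi' r by exact: psi'P.
  move: r; apply: (continuous_eq_dense qd) => // i.
  apply: (@cvg_scalar_unique R k _ U (fun n => C (phi (j n)) (q i)));
    last exact: psi'P.
  apply/cvgrPdist_lt => r r0; apply: ooU.
  near=> n; apply: (@lt_le_trans _ _ (mkK n.+1%:R^-1 0)).
    by apply: (jP n).2; near: n; exact: nbhs_infty_ge.
  rewrite -[leRHS]mkK_reK ?(ltW r0)// ler_mkK ltW//.
  by near: n; exact: (near_infty_natSinv_lt (PosNum (reK_gt0 r0))).
have e80 : 0 < e / 8 by rewrite divr_gt0.
(* The lower bound on the increments [phi n f] survives in the limit functional [psi]. *)
have C0 : ~ `|C psi 0| < e / 2.
  move=> lt0.
  have /cvgrPdist_lt/(_ (e / 2 - `|C psi 0|)) := psiP (Cb_translate 0 f).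
  rewrite subr_gt0 => /(_ lt0) /filter_ex[n /= nP].
  have [_] := xP n; apply.
  have <- : C (phi n) 0 = (f (t n) - f (s n)) (x n).
    by rewrite /C (phiP n).2 /= !addr0.
  rewrite -[C (phi n) 0](subrK (C psi 0)) (le_trans (ler_normD _ _))//.
  by rewrite distrC -lerBrDr ltW.
have [d0 /= d00 d0P] : \forall r \near (0 : R), `|C psi 0 - C psi r| <= e / 8.
  exact: ((cvgrPdist_le _ _).1 (cC psi 0) _ e80).
have [t0 [d [m [dgt0 dP]]]] :=
  pointwise_cvg_uniform_ball (cC psi) (fun n => cC (phi (j n))) jC e80 d00.
(* [N] is chosen so that [N * (e / 4)] exceeds [|f| + |f|], the most that a telescoped sum of
   increments can reach. *)
pose N := Num.bound (reK ((`|f| + `|f|) / (e / 4))).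
have N1 : 0 < (N.+1%:R : R) by [].
(* Since [n <= j n], the increment length is below [1 / (n + 1)], so [N] such steps from [t0] stay
   within distance [d]. *)
have [n [mn hn]] : exists n, (m <= n)%N /\ N%:R * n.+1%:R^-1 < d.
  apply: (@filter_ex _ \oo); near=> n; split.
    by near: n; exact: nbhs_infty_ge.
  apply: (@le_lt_trans _ _ (N.+1%:R * n.+1%:R^-1)).
    by rewrite ler_wpM2r// ler_nat.
  rewrite -ltr_pdivlMl// mulrC; near: n.
  exact: (near_infty_natSinv_lt (PosNum (divr_gt0 dgt0 N1))).
(* With this [a], the value of [phi (j n)] on the translate of [f] by [r] is exactly
   [a (r + h) - a r]. *)
pose h := t (j n) - s (j n); pose a r : K := f (s (j n) + r) (x (j n)).
have aM r : `|a r| <= `|f|.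
  rewrite (le_trans (blin_le_norm _ _))// -[leRHS]mulr1.
  by rewrite ler_pM ?Cb_le_norm ?(xP _).1.
have Nh : N%:R * `|h| < d.
  apply: le_lt_trans hn; rewrite ler_wpM2l// (le_trans (ltW (st _).1))//.
  by rewrite lef_pV2 ?posrE// ler_nat ltnS (jP n).1.
have e40 : 0 <= e / 4 by rewrite divr_ge0// ltW.
have ac r : `|r - t0| < d -> `|C psi 0 - (a (r + h) - a r)| <= e / 4.
  move=> rt0; have [rd0 rn] := dP r n rt0 mn.
  have -> : a (r + h) - a r = C (phi (j n)) r.
    by rewrite /C (phiP _).2 dualB /a /h /= addrCA subrKC addrC.
  rewrite -[C psi 0](subrK (C psi r)) -addrA (le_trans (ler_normD _ _))//.
  have -> : e / 4 = e / 8 + e / 8 by field.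
  by rewrite lerD//; apply: d0P; rewrite /= sub0r normrN.
have := bounded_increments aM e40 Nh ac.
have C0' : e / 2 <= `|C psi 0|.
  by rewrite real_leNgt ?ger0_real ?(ltW e20)//; exact/negP.
move=> NC; have : N%:R * (e / 2) <= `|f| + `|f| + N%:R * (e / 4).
  by apply: le_trans NC; rewrite ler_wpM2l.
have -> : e / 2 = e / 4 + e / 4 by field.
rewrite mulrDr lerD2r -ler_pdivlMr ?divr_gt0// => /ler_reK.
rewrite reK_nat leNgt; apply/negP; rewrite negbK.
apply: archi_boundP; rewrite reK_ge0// divr_ge0// addr_ge0.
Unshelve. all: by end_near. Qed.

End WAP_unif_continuous.

(** * The splitting *)

Section projections.
Variables (R : realType) (k : scalar_kind).
Local Notation K := (scalar_field R k).

Lemma closed_ker (V W : normedModType K) (P : blin V W) :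
  closed [set v | P v = 0].
Proof.
have -> : [set v | P v = 0] = P @^-1` [set 0] by [].
apply: preimage_closed; first by move=> v _; exact: blin_continuous.
exact/accessible_closed_set1/hausdorff_accessible/norm_hausdorff.
Qed.

Lemma ker_submod_closed (V W : normedModType K) (P : blin V W) :
  submod_closed (mem [set v | P v = 0] : {pred V}).
Proof.
split=> [|a u v]; rewrite !inE /=; first exact: linear0.
by rewrite blin_linearE => -> ->; rewrite scaler0 addr0.
Qed.

Lemma idempotent_splitting (V : normedModType K) (P : blin V V) :
  blin_comp P P = P -> splitting (range P) [set v | P v = 0].
Proof.
move=> PP; have PPv v : P (P v) = P v by rewrite -[in RHS]PP.
have cid : (id : V -> V) \in @blin_pred R k V V.
  by rewrite inE; split=> // x; exact: cvg_id.
(* Writing the range as the kernel of [P - id] makes it a closed subspace. *)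
have rangeE : range P = [set v | (P - Blin cid) v = 0].
  apply/seteqP; split=> [_ [v _ <-]|v]; rewrite /mkset blinB.
    by rewrite /= PPv subrr.
  by move=> /subr0_eq Pv; exists v.
split.
- by rewrite rangeE; split; [exact: ker_submod_closed|exact: closed_ker].
- by split; [exact: ker_submod_closed|exact: closed_ker].
- move=> v; exists (P v, v - P v); split.
    split; [by exists v| |by rewrite /= addrC subrK].
    by rewrite /= blin_sub PPv subrr.
  move=> [_ b] [/= [a _ <-] Pb ->].
  by rewrite linearD /= Pb addr0 PPv addrC addKr.
Qed.

End projections.

(** * Action of the sun semigroup on almost periodic and weakly almost periodic functions *)

Section corollary.
Variables (R : realType) (k : scalar_kind).
Local Notation K := (scalar_field R k).
Variable X : normedModType K.
Local Notation BUCX := (BUC (dual X)).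
Local Notation op := (blin BUCX BUCX).
Implicit Types (P V : op) (f : BUCX).

(** Both sides at [s] are limits along the same ultrafilter of the values of [f] at [s + t + r]. *)
Lemma S0sun_Tsun V t f :
  S0sun V -> V (Tsun (dual X) t f) = Tsun (dual X) t (V f).
Proof.
move=> /S0sun_ultra[U [UU _ UV]]; apply: BUC_dual_ext => s x.
have c1 := UV (Tsun (dual X) t f) s x.
apply: (@cvg_scalar_unique R k _ _ _ _ _ _ c1).
have c2 := UV f (s + t) x; rewrite /=.
by under eq_fun do rewrite addrAC.
Qed.

Lemma Cb_translate_BUC_Cb t f :
  Cb_translate t (BUC_Cb f) = BUC_Cb (Tsun (dual X) t f).
Proof. exact: Cb_ext. Qed.

Lemma AP_fixed P f : idempotent_in (@S0sun R k X) P -> AP (BUC_Cb f) -> P f = f.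
Proof.
move=> [SP PP] fAP; have [U [UU Pd PU]] := S0sun_ultra SP.
have [g fg] := AP_ultra_cvg id fAP UU.
(* Point evaluations identify the norm limit of the translates with the weak-* limit [P f]. *)
have gE : g = BUC_Cb (P f).
  apply: Cb_dual_ext => s x; have [phi _ phiE] := Cb_eval s x.
  apply: (@cvg_scalar_unique R k _ U (fun t => f (s + t) x)); last exact: PU.
  have : phi (Cb_translate t (BUC_Cb f)) @[t --> U] --> (phi g : K).
    exact: (@cvg_comp _ _ _ (fun t => Cb_translate t (BUC_Cb f)) phi _ _ _ fg
      (@blin_continuous _ _ _ _ phi g)).
  rewrite phiE; under eq_fun do rewrite phiE.
  exact.
apply/eqP; rewrite -subr_eq0 -normr_le0; apply/ler_addgt0Pr => e e0.
rewrite add0r.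
have e20 : 0 < e / 2 by rewrite divr_gt0.
move: fg => /cvgrPdist_lt/(_ _ e20)/filter_ex[t].
rewrite gE Cb_translate_BUC_Cb norm_BUC_CbB.
set Tf := Tsun _ t f => PfT.
have -> : `|P f - f| = `|P Tf - Tf|.
  by rewrite (S0sun_Tsun _ _ SP); exact/esym/norm_TsunB.
rewrite -[P Tf](subrK (P f)) -addrA (le_trans (ler_normD _ _))//.
rewrite [leRHS]splitr lerD ?(ltW PfT)//.
(* Idempotence rewrites [P f] as [P (P f)]; then [P] being a contraction bounds the difference by
   [|Tf - P f|]. *)
have -> : P Tf - P f = P (Tf - P f).
  rewrite blin_sub; congr (_ - _).
  by rewrite -[in LHS]PP.
rewrite (le_trans _ (ltW PfT))// distrC.
by apply: BUC_norm_le; have [] := Pd (Tf - P f).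
Qed.

Lemma WAP_commute P V f : S0sun P -> S0sun V -> WAP (BUC_Cb f) ->
  V (P f) = P (V f).
Proof.
move=> SP SV fW; have [U [UU _ PU]] := S0sun_ultra SP.
have [U' [UU' _ VU]] := S0sun_ultra SV.
apply: BUC_dual_ext => s x.
have [g fg] := WAP_ultra_cvg id fW UU'.
have gE : g = BUC_Cb (V f).
  apply: Cb_dual_ext => r y; have [phi _ phiE] := Cb_eval r y.
  apply: (@cvg_scalar_unique R k _ U' (fun t => f (r + t) y)); last exact: VU.
  have := fg phi; rewrite phiE; under eq_fun do rewrite phiE.
  exact.
(* The limit [phi] of these evaluations along [U] is a bounded functional on all of C_b that
   computes [P h s x] for [h] in BUC, so weak convergence may be tested against it. *)
have /choice[ev evP] r : exists phi : dual (Cb (dual X)), `|phi| <= `|x| /\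
    forall u, phi u = u (s + r) x :> K.
  by have [phi] := Cb_eval (s + r) x; exists phi.
have [|phi _ phiP] := @ultra_dual_cvg _ _ _ _ _ ev _ UU (normr_ge0 x).
  by apply: nearW => r; exact: (evP r).1.
have phiE (h : BUCX) : phi (BUC_Cb h) = P h s x :> K.
  apply: (@cvg_scalar_unique R k _ U (fun r => h (s + r) x)); last exact: PU.
  by have := phiP (BUC_Cb h); under eq_fun do rewrite (evP _).2.
(* Along [U'] the numbers [P f (s + t) x] tend to [V (P f) s x] by definition of [V], and to
   [phi (V f) = P (V f) s x] by weak convergence of the translates of [f]. *)
apply: (@cvg_scalar_unique R k _ U' (fun t => P f (s + t) x)); first exact: VU.
have := fg phi; rewrite gE phiE.
suff -> : (fun t => phi (Cb_translate t (BUC_Cb f)) : K) =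
    (fun t => P f (s + t) x) by [].
by apply/funext => t; rewrite Cb_translate_BUC_Cb phiE S0sun_Tsun.
Qed.

Lemma WAP0_killed P f : minimal_idempotent (@S0sun R k X) P ->
  WAP0 (BUC_Cb f) -> P f = 0.
Proof.
move=> Pmin [fW [t t0]].
have [N [UN ooN]] := ultraFilterLemma eventually_filter.
have [V SV VU] := @ultra_S0sun R k X _ (fmap_ultra t UN).
have Vf : V f = 0.
  apply: BUC_dual_ext => s x; have [phi _ phiE] := Cb_eval s x.
  apply: (@cvg_scalar_unique R k _ N (fun n => f (s + t n) x)); first exact: VU.
  have F1 : Filter ((fun n => Cb_translate (t n) (BUC_Cb f)) @ \oo).
    exact: fmap_filter.
  have := (@initial_ptws_cvgP _ _ _ (@eval_dual R k (Cb (dual X))) _ 0 F1).1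
    t0 phi.
  rewrite /eval_dual.
  have -> : phi 0 = 0 :> K by exact: dual0.
  have -> : (fun n => f (s + t n) x : K) =
      (fun n => phi (Cb_translate (t n) (BUC_Cb f))).
    by apply/funext => n; rewrite phiE.
  by move=> c0 B /c0; exact: ooN.
have [W SW ->] := minimal_idempotent_recover Pmin SV.
have [[SP _] _] := Pmin.
by rewrite /= (WAP_commute SP SV fW) Vf !linear0.
Qed.

End corollary.

Theorem corollary9p3 (R : realType) (k : scalar_kind)
    (X : completeNormedModType (scalar_field R k))
    (apX : approximation_property (dual X)) :
  (exists P : blin (BUC (dual X)) (BUC (dual X)),
     minimal_idempotent (@S0sun R k X) P) /\
  (forall P : blin (BUC (dual X)) (BUC (dual X)),
     minimal_idempotent (@S0sun R k X) P ->
     [/\ splitting (BUC_a P) (BUC_0 P),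
         @AP R k (dual X) `<=` @BUC_Cb R k (dual X) @` BUC_a P &
         @WAP0 R k (dual X) `<=` @BUC_Cb R k (dual X) @` BUC_0 P]).
Proof.
split=> [|P Pmin]; first exact: minimal_idempotent_exists.
have [[SP PP] _] := Pmin; split; first exact: idempotent_splitting.
  move=> f fAP; have [g fg] := unif_continuous_BUC_Cb (AP_unif_continuous fAP).
  by exists g => //; exists g => //; apply: AP_fixed => //; rewrite -fg.
move=> f fW; have [g fg] := unif_continuous_BUC_Cb (WAP_unif_continuous fW.1).
by exists g => //; apply: (WAP0_killed Pmin); rewrite -fg.
Qed.
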